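(* Let $(X,L)$ be a measurable bundle of $C^*$-algebras over $\Omega$ (with the standing assumptions in the context) and let $\varphi:L_0(\Omega,X)\to L_0$ be an $L_0$-state. Then there exists a measurable bundle of states $\{\varphi_\omega\}_{\omega\in\Omega}$, with $\varphi_\omega$ a state on $X(\omega)$, such that for every $x\in L_0(\Omega,X)$ $$\varphi(x)(\omega)=\varphi_\omega(x(\omega))\quad\text{for almost every }\omega\in\Omega.$$
   Context: $(\Omega,\Sigma,\lambda)$ is a measure space with finite complete measure $\lambda$; $M(\Omega)$ is the set of measurable complex functions on $\Omega$ (defined almost everywhere); $L_0=L_0(\Omega)$ is the algebra of a.e.-equivalence classes of measurable complex functions, with the a.e. order on real elements and unit $\mathbf 1$. $\mathcal L^\infty(\Omega)$ is the set of bounded measurable functions on $\Omega$ (defined everywhere, sup norm), and $L^\infty(\Omega)=\{f\in L_0:|f|\le\alpha\mathbf 1\text{ for some }\alpha>0\}$ with the usual norm. Measurable bundle of $C^*$-algebras: $X$ assigns to each $\omega\in\Omega$ a $C^*$-algebra $X(\omega)\ne\{0\}$. A section is a function $u$ defined a.e. on $\Omega$ with $u(\omega)\in X(\omega)$ for $\omega\in\mathrm{dom}(u)$. $(X,L)$, with $L$ a set of sections, is a measurable bundle of $C^*$-algebras if: $L$ is closed under complex linear combinations, products and involution (all defined pointwise on the intersections of the domains); for each $c\in L$ the function $\omega\mapsto\|c(\omega)\|_{X(\omega)}$ is measurable; and for every $\omega\in\Omega$ the set $\{c(\omega):c\in L,\ \omega\in\mathrm{dom}(c)\}$ is dense in $X(\omega)$.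 A section $s$ is simple if $s(\omega)=\sum_{i=1}^n\chi_{A_i}(\omega)c_i(\omega)$ for a.e. $\omega$, with $c_i\in L$, $A_i\in\Sigma$. A section $u$ is measurable if there are simple sections $s_n$ with $s_n(\omega)\to u(\omega)$ for a.e. $\omega$. $M(\Omega,X)$ is the set of measurable sections; $L_0(\Omega,X)$ is its quotient by a.e. equality; $\widehat u$ is the class of $u$; $\|\widehat u\|\in L_0$ is the class of $\omega\mapsto\|u(\omega)\|_{X(\omega)}$. With pointwise operations $L_0(\Omega,X)$ is a $*$-algebra and an $L_0$-module. $L^\infty(\Omega,X)=\{\widehat u\in L_0(\Omega,X):\|\widehat u\|\in L^\infty(\Omega)\}$, and $\mathcal L^\infty(\Omega,X)=\{u\in M(\Omega,X):\|u(\cdot)\|_{X(\cdot)}\in\mathcal L^\infty(\Omega)\}$. For $x\in L_0(\Omega,X)$, $x(\omega)$ denotes the value at $\omega$ of any representative. Lifting: $p:L^\infty(\Omega)\to\mathcal L^\infty(\Omega)$ is a (unital) algebra homomorphism with $p(f)\in f$, $\mathrm{dom}\,p(f)=\Omega$ and $\|p(f)\|_{\mathcal L^\infty(\Omega)}=\|f\|_{L^\infty(\Omega)}$. A vector-valued lifting associated with $p$ is a map $\ell:L^\infty(\Omega,X)\to\mathcal L^\infty(\Omega,X)$ such that $\ell(u)\in u$, $\mathrm{dom}\,\ell(u)=\Omega$, $\|\ell(u)(\omega)\|_{X(\omega)}=p(\|u\|)(\omega)$, $\ell(u+v)=\ell(u)+\ell(v)$, $\ell(fu)=p(f)\ell(u)$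 for $f\in L^\infty(\Omega)$, $\ell(u^* )=\ell(u)^*$, $\ell(uv)=\ell(u)\ell(v)$, and $\{\ell(u)(\omega):u\in L^\infty(\Omega,X)\}$ is dense in $X(\omega)$ for every $\omega$. Standing assumptions: $(X,L)$ admits a vector-valued lifting $\ell$ (associated with a lifting $p$), and $L_0(\Omega,X)$ has a unit $e$ with $\|e\|=\mathbf 1$; $e(\omega):=\ell(e)(\omega)$ is then the unit of $X(\omega)$. A state on a unital $C^*$-algebra is a positive linear functional of norm $1$. A family $\{\varphi_\omega\}_{\omega\in\Omega}$ of states $\varphi_\omega$ on $X(\omega)$ is a measurable bundle of states if $\omega\mapsto\varphi_\omega(x(\omega))$ belongs to $M(\Omega)$ for every $x\in M(\Omega,X)$. A map $f:L_0(\Omega,X)\to L_0$ is $L_0$-linear if $f(\alpha x+\beta y)=\alpha f(x)+\beta f(y)$ for $\alpha,\beta\in L_0$; it is $L_0$-bounded if $|f(x)|\le c\|x\|$ for all $x$ and some $c\in L_0$, and then $\|f\|=\sup\{|f(x)|:\|x\|\le\mathbf 1\}\in L_0$. It is positive if $f(xx^* )\ge0$ for all $x$. An $L_0$-state is a positive $L_0$-linear ($L_0$-bounded) functional with $\|f\|=\mathbf 1$. *)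

(* Defs.v *)
From HB Require Import structures.
From mathcomp Require Import all_boot all_order all_algebra.
From mathcomp Require Import all_classical all_reals all_analysis.
From mathcomp Require Import generic_quotient measurable_realfun.
From mathcomp.real_closed Require Import complex.
Set Implicit Arguments.
Unset Strict Implicit.
Unset Printing Implicit Defensive.
Import Order.TTheory GRing.Theory Num.Theory numFieldNormedType.Exports.
Local Open Scope classical_set_scope.
Local Open Scope ring_scope.
Local Open Scope complex_scope.

(* A C*-algebra, not assumed unital.  The norm of an R[i]-normed module takes
   its values in the nonnegative elements of R[i]. *)
HB.mixin Record isCStarAlgebra (R : realType) (V : Type)
    of CompleteNormedModule R[i] V := {
  cmul : V -> V -> V;
  cstar : V -> V;
  cmulA : associative cmul;
  cmulDl : left_distributive cmul +%R;
  cmulDr : right_distributive cmul +%R;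
  cmulZl : forall (a : R[i]) (x y : V), cmul (a *: x) y = a *: cmul x y;
  cmulZr : forall (a : R[i]) (x y : V), cmul x (a *: y) = a *: cmul x y;
  cstarK : involutive cstar;
  cstarD : {morph cstar : x y / x + y};
  cstarZ : forall (a : R[i]) (x : V), cstar (a *: x) = a^* *: cstar x;
  cstarM : forall x y : V, cstar (cmul x y) = cmul (cstar y) (cstar x);
  normcM : forall x y : V, `|cmul x y| <= `|x| * `|y|;
  normcstarM : forall x : V, `|cmul (cstar x) x| = `|x| ^+ 2
}.

#[short(type="cstarAlgType")]
HB.structure Definition CStarAlgebra (R : realType) :=
  { V of isCStarAlgebra R V & CompleteNormedModule R[i] V }.

Definition is_state (R : realType) (A : cstarAlgType R) (f : {scalar A}) :=
  (forall x : A, 0 <= f (cmul x (cstar x))) /\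
  (let S := [set complex.Re `|f x| | x in [set x : A | `|x| <= 1]] in
   has_ubound S /\ sup S = 1).

Record completeFiniteMeasure d (T : measurableType d) (R : realType) :=
  CompleteFiniteMeasure {
    cfmeasure :> {finite_measure set T -> \bar R};
    cfmeasure_complete : measure_is_complete cfmeasure }.

(* Functions and sections need not be defined everywhere: the domain of u is
   the set of points where u w is not None. *)
Definition psection (T : Type) (V : T -> Type) := forall w, option (V w).

Definition pdom (T : Type) (V : T -> Type) (u : psection V) : set T :=
  [set w | isSome (u w)].

Definition omap2 (A B C : Type) (f : A -> B -> C) (a : option A)
    (b : option B) : option C :=
  match a, b with Some x, Some y => Some (f x y) | _, _ => None end.

Section ae_quotient.
Context d (T : measurableType d) (R : realType).
Variables (mu : completeFiniteMeasure T R) (V : T -> Type).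
Variable P : set (psection V).

Record psub := PSub { psub_val : psection V; psubP : P psub_val }.

HB.instance Definition _ := gen_eqMixin psub.
HB.instance Definition _ := gen_choiceMixin psub.

Definition pae_eq (u v : psub) :=
  `[< {ae mu, forall w, psub_val u w = psub_val v w} >].

Let pae_eq_refl : reflexive pae_eq.
Proof. by move=> u; apply/asboolP/aeW. Qed.

Let pae_eq_sym : symmetric pae_eq.
Proof.
move=> u v; apply/idP/idP => /asboolP h; apply/asboolP.
  by apply: filterS h => w ->.
by apply: filterS h => w ->.
Qed.

Let pae_eq_trans : transitive pae_eq.
Proof.
move=> v u w /asboolP uv /asboolP vw; apply/asboolP.
by apply: filterS2 uv vw => x -> ->.
Qed.

Canonical pae_eq_canonical :=
  EquivRel pae_eq pae_eq_refl pae_eq_sym pae_eq_trans.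

Local Open Scope quotient_scope.

Definition aequot : Type := {eq_quot pae_eq}.
HB.instance Definition _ := Choice.on aequot.
HB.instance Definition _ := EqQuotient.on aequot.

Definition aeclass (u : psection V) (Pu : P u) : aequot :=
  \pi_aequot (PSub Pu).

(* The value x(w) of a class depends on the chosen representative, so it is
   meaningful only almost everywhere. *)
Definition aerepr (x : aequot) : psection V := psub_val (repr x).

Lemma aereprP x : P (aerepr x). Proof. exact: psubP. Qed.

Lemma aeclassK u (Pu : P u) : {ae mu, forall w, aerepr (aeclass Pu) w = u w}.
Proof.
have : aeclass Pu == \pi_aequot (repr (aeclass Pu)) by rewrite reprK.
rewrite eqmodE => /asboolP; rewrite /aerepr /=.
by apply: filterS => w ->.
Qed.

Lemma aequotP x y :
  x = y <-> {ae mu, forall w, aerepr x w = aerepr y w}.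
Proof.
split=> [->|xy]; first exact: aeW.
rewrite -[x]reprK -[y]reprK; apply/eqP; rewrite eqmodE; exact/asboolP.
Qed.

End ae_quotient.
Arguments aeclass {d T R} mu {V P u}.

Section L0.
Context d (T : measurableType d) (R : realType).
Variable mu : completeFiniteMeasure T R.
Local Notation C := R[i].
Local Notation Re := complex.Re.
Local Notation Im := complex.Im.

(* M(Omega): complex measurability is that of the real and imaginary parts. *)
Definition mcfun (f : psection (fun _ : T => C)) :=
  [/\ {ae mu, forall w, f w},
      measurable_fun (pdom f) (fun w => Re (odflt 0 (f w))) &
      measurable_fun (pdom f) (fun w => Im (odflt 0 (f w)))].

Let measurable_pdom (V : T -> Type) (u : psection V) :
  {ae mu, forall w, u w} -> measurable (pdom u).
Proof.
move=> u_ae; rewrite -[pdom u]setCK; apply: measurableC.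
by apply: (cfmeasure_complete (c := mu)); apply: negligibleS u_ae.
Qed.

Lemma ae_measurable_real (f g : T -> R) : {ae mu, forall w, f w = g w} ->
  measurable_fun setT f -> measurable_fun setT g.
Proof.
move=> fg mf; apply/measurable_EFinP.
apply: (@ae_measurable_fun _ _ _ mu (@cfmeasure_complete _ _ _ mu)
          setT (EFin \o f)); last exact/measurable_EFinP.
by apply: filterS fg => w /= -> _.
Qed.

Lemma mcfun_total (f : psection (fun _ : T => C)) (g : T -> C) :
  measurable_fun setT (fun w => Re (g w)) ->
  measurable_fun setT (fun w => Im (g w)) ->
  {ae mu, forall w, f w = Some (g w)} -> mcfun f.
Proof.
move=> mRe mIm fg; split; first by apply: filterS fg => w ->.
- apply: (@measurable_funS _ _ _ _ setT) => //.
  by apply: ae_measurable_real mRe; apply: filterS fg => w ->.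
- apply: (@measurable_funS _ _ _ _ setT) => //.
  by apply: ae_measurable_real mIm; apply: filterS fg => w ->.
Qed.

Lemma total_mcfun (f : psection (fun _ : T => C)) : mcfun f ->
  measurable_fun setT (fun w => Re (odflt 0 (f w))) /\
  measurable_fun setT (fun w => Im (odflt 0 (f w))).
Proof.
move=> [f_ae mRe mIm]; have mD := measurable_pdom f_ae.
rewrite -(setUv (pdom f)).
split; apply/measurable_funU => //; try exact: measurableC.
- split => //; apply: (@eq_measurable_fun _ _ _ _ _ (cst (0 : R))).
    by move=> w; rewrite inE /pdom /=; case: (f w).
  exact: measurable_cst.
- split => //; apply: (@eq_measurable_fun _ _ _ _ _ (cst (0 : R))).
    by move=> w; rewrite inE /pdom /=; case: (f w).
  exact: measurable_cst.
Qed.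

Lemma mcfun_cst (a : C) : mcfun (fun=> Some a).
Proof. by apply: (@mcfun_total _ (fun=> a)) => //; apply: aeW. Qed.

Lemma mcfunD f g : mcfun f -> mcfun g -> mcfun (fun w => omap2 +%R (f w) (g w)).
Proof.
move=> mf mg.
have [[f_ae _ _] [g_ae _ _]] := (mf, mg).
have [[Rf If] [Rg Ig]] := (total_mcfun mf, total_mcfun mg).
apply: (@mcfun_total _ (fun w => odflt 0 (f w) + odflt 0 (g w))).
- have := measurable_funD Rf Rg; apply: eq_measurable_fun => w _.
  by rewrite /=; case: (odflt 0 (f w)) (odflt 0 (g w)) => ? ? [].
- have := measurable_funD If Ig; apply: eq_measurable_fun => w _.
  by rewrite /=; case: (odflt 0 (f w)) (odflt 0 (g w)) => ? ? [].
- by apply: filterS2 f_ae g_ae => w; case: (f w) (g w) => // ? [].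
Qed.

Lemma mcfunM f g : mcfun f -> mcfun g -> mcfun (fun w => omap2 *%R (f w) (g w)).
Proof.
move=> mf mg.
have [[f_ae _ _] [g_ae _ _]] := (mf, mg).
have [[Rf If] [Rg Ig]] := (total_mcfun mf, total_mcfun mg).
apply: (@mcfun_total _ (fun w => odflt 0 (f w) * odflt 0 (g w))).
- have := measurable_funB (measurable_funM Rf Rg) (measurable_funM If Ig).
  apply: eq_measurable_fun => w _.
  by rewrite /=; case: (odflt 0 (f w)) (odflt 0 (g w)) => ? ? [].
- have := measurable_funD (measurable_funM Rf Ig) (measurable_funM If Rg).
  apply: eq_measurable_fun => w _.
  by rewrite /=; case: (odflt 0 (f w)) (odflt 0 (g w)) => ? ? [].
- by apply: filterS2 f_ae g_ae => w; case: (f w) (g w) => // ? [].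
Qed.

Lemma mcfun_norm f : mcfun f -> mcfun (fun w => omap Num.norm (f w)).
Proof.
move=> mf; have [f_ae _ _] := mf; have [Rf If] := total_mcfun mf.
apply: (@mcfun_total _ (fun w => `|odflt 0 (f w)|)).
- have mR := measurable_funX 2 Rf; have mI := measurable_funX 2 If.
  have := measurableT_comp (continuous_measurable_fun (@sqrt_continuous R)) (measurable_funD mR mI).
  apply: eq_measurable_fun => w _.
  by rewrite /=; case: (odflt 0 (f w)).
- apply: (@eq_measurable_fun _ _ _ _ _ (cst (0 : R))).
    by move=> w _; rewrite /=; case: (odflt 0 (f w)).
  exact: measurable_cst.
- by apply: filterS f_ae => w; case: (f w).
Qed.

End L0.

Section real_norm.
Context (R : realType).
Local Notation Re := complex.Re.

Definition rnorm (V : normedZmodType R[i]) (x : V) : R := Re `|x|.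

Lemma rnormE (V : normedZmodType R[i]) (x : V) : `|x| = (rnorm x)%:C.
Proof.
rewrite /rnorm; case: `|x| (normr_ge0 x) => a b; rewrite lecE /= => /andP[].
by move=> /eqP ->.
Qed.

Lemma rnorm_ge0 (V : normedZmodType R[i]) (x : V) : 0 <= rnorm x.
Proof. by rewrite -lecR -rnormE normr_ge0. Qed.

Lemma rnorm_triangle (V : normedZmodType R[i]) (x y : V) :
  rnorm (x + y) <= rnorm x + rnorm y.
Proof. by rewrite -lecR rmorphD /= -!rnormE ler_normD. Qed.

Lemma rnorm_dist (V : normedZmodType R[i]) (x y : V) :
  `|rnorm x - rnorm y| <= rnorm (x - y).
Proof.
have xy := rnorm_triangle (x - y) y; rewrite subrK in xy.
have yx := rnorm_triangle (y - x) x; rewrite subrK in yx.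
have e : rnorm (y - x) = rnorm (x - y) by rewrite /rnorm distrC.
rewrite ler_norml lerBlDr xy andbT lerNl opprB lerBlDr.
by rewrite -e.
Qed.

Lemma rnormN (V : normedZmodType R[i]) (x : V) : rnorm (- x) = rnorm x.
Proof. by rewrite /rnorm normrN. Qed.

Lemma rnormZ (V : normedModType R[i]) (a : R[i]) (x : V) :
  rnorm (a *: x) = rnorm a * rnorm x.
Proof.
by apply: (fmorph_inj (real_complex R)); rewrite rmorphM /= -!rnormE normrZ.
Qed.

Lemma rnormR (a : R) : rnorm a%:C = `|a|.
Proof. by rewrite /rnorm /= expr0n /= addr0 sqrtr_sqr. Qed.

Lemma rnormM (A : cstarAlgType R) (x y : A) :
  rnorm (cmul x y) <= rnorm x * rnorm y.
Proof. by rewrite -lecR rmorphM /= -!rnormE normcM. Qed.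

Lemma rnorm_star_le (A : cstarAlgType R) (x : A) :
  rnorm x <= rnorm (cstar x).
Proof.
have [->|x0] := eqVneq (rnorm x) 0; first exact: rnorm_ge0.
rewrite -(@ler_pM2r _ (rnorm x)); last by rewrite lt_neqAle eq_sym x0 rnorm_ge0.
apply: le_trans (rnormM _ _); rewrite -lecR rmorphM /= -!rnormE normcstarM.
by rewrite expr2.
Qed.

Lemma rnorm_star (A : cstarAlgType R) (x : A) : rnorm (cstar x) = rnorm x.
Proof.
apply/eqP; rewrite eq_le rnorm_star_le andbT.
by have := rnorm_star_le (cstar x); rewrite cstarK.
Qed.

Lemma cvg_rnormP (V : normedModType R[i]) (u : nat -> V) (l : V) :
  (u n @[n --> \oo] --> l) <-> (rnorm (l - u n) @[n --> \oo] --> (0 : R)).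
Proof.
split=> [/cvgrPdist_lt ul|/cvgrPdist_lt ul].
  apply/cvgrPdist_lt => e e0.
  have /ul : 0 < e%:C by rewrite ltcR.
  apply: filterS => n; rewrite rnormE ltcR sub0r normrN ger0_norm //.
  exact: rnorm_ge0.
apply/cvgrPdist_lt => -[a b]; rewrite ltcE /= => /andP[/eqP -> a0].
apply: filterS (ul a a0) => n; rewrite sub0r normrN ger0_norm ?rnorm_ge0//.
by rewrite rnormE -ltcR.
Qed.

Lemma rnorm_cvg (V : normedModType R[i]) (u : nat -> V) (l : V) :
  (u n @[n --> \oo] --> l) -> rnorm (u n) @[n --> \oo] --> rnorm l.
Proof.
move/cvg_rnormP => /cvgrPdist_lt ul; apply/cvgrPdist_lt => e e0.
apply: filterS (ul e e0) => n; rewrite sub0r normrN ger0_norm ?rnorm_ge0//.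
exact/le_lt_trans/rnorm_dist.
Qed.

Let squeeze0 (a b : nat -> R) : (forall n, 0 <= a n <= b n) ->
  b n @[n --> \oo] --> (0 : R) -> a n @[n --> \oo] --> (0 : R).
Proof.
move=> ab b0; apply: (@squeeze_cvgr _ _ _ _ (cst 0) b) => //.
  exact: nearW.
exact: cvg_cst.
Qed.

Lemma cvg_cmul (A : cstarAlgType R) (u v : nat -> A) (l m : A) :
  (u n @[n --> \oo] --> l) -> (v n @[n --> \oo] --> m) ->
  cmul (u n) (v n) @[n --> \oo] --> cmul l m.
Proof.
move=> ul vm; apply/cvg_rnormP.
pose b n := rnorm (l - u n) * rnorm (v n) + rnorm l * rnorm (m - v n).
apply: (@squeeze0 _ b) => [n|].
  rewrite rnorm_ge0 /=.
  have -> : cmul l m - cmul (u n) (v n) =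
            cmul (l - u n) (v n) + cmul l (m - v n).
    by rewrite cmulDl cmulDr -[- u n]scaleN1r -[- v n]scaleN1r cmulZl
      cmulZr !scaleN1r [RHS]addrC addrA subrK.
  by apply: le_trans (rnorm_triangle _ _) _; rewrite lerD // rnormM.
rewrite (_ : 0 = 0 * rnorm m + rnorm l * 0); last by rewrite mul0r mulr0 addr0.
apply: cvgD; apply: cvgM.
- exact/cvg_rnormP.
- exact: rnorm_cvg.
- exact: cvg_cst.
- exact/cvg_rnormP.
Qed.

Lemma cvg_cstar (A : cstarAlgType R) (u : nat -> A) (l : A) :
  (u n @[n --> \oo] --> l) -> cstar (u n) @[n --> \oo] --> cstar l.
Proof.
move/cvg_rnormP => ul; apply/cvg_rnormP.
rewrite (_ : (fun n => _) = fun n => rnorm (l - u n)) //.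
apply/funext => n; rewrite -[RHS]rnorm_star cstarD -scaleN1r.
by rewrite -[X in _ = rnorm (_ + cstar X)]scaleN1r cstarZ rmorphN rmorph1.
Qed.

Lemma cvg_scale_real (V : normedModType R[i]) (a : nat -> R) (b : R)
    (u : nat -> V) (l : V) :
  (a n @[n --> \oo] --> b) -> (u n @[n --> \oo] --> l) ->
  (a n)%:C *: u n @[n --> \oo] --> b%:C *: l.
Proof.
move=> ab ul; apply/cvg_rnormP.
pose c n := `|b - a n| * rnorm (u n) + `|b| * rnorm (l - u n).
apply: (@squeeze0 _ c) => [n|].
  rewrite rnorm_ge0 /= /c -!rnormR -!rnormZ.
  have -> : b%:C *: l - (a n)%:C *: u n =
            (b - a n)%:C *: u n + b%:C *: (l - u n).
    by rewrite rmorphB scalerBl scalerBr [RHS]addrC addrA subrK.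
  exact: rnorm_triangle.
rewrite (_ : 0 = `|b - b| * rnorm l + `|b| * 0); last first.
  by rewrite subrr normr0 mul0r mulr0 addr0.
apply: cvgD; apply: cvgM.
- by apply: cvg_norm; apply: cvgB => //; exact: cvg_cst.
- exact: rnorm_cvg.
- exact: cvg_cst.
- exact/cvg_rnormP.
Qed.

End real_norm.

Record cstarBundle d (T : measurableType d) (R : realType)
    (mu : completeFiniteMeasure T R) := CStarBundle {
  fiber :> T -> cstarAlgType R;
  fiber_neq0 : forall w, exists x : fiber w, x != 0;
  bsec : set (psection fiber);
  bsec_ae : forall c, bsec c -> {ae mu, forall w, c w};
  bsec_lin : forall (a b : R[i]) c c', bsec c -> bsec c' ->
    bsec (fun w => omap2 +%R (omap ( *:%R a) (c w)) (omap ( *:%R b) (c' w)));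
  bsecM : forall c c', bsec c -> bsec c' ->
    bsec (fun w => omap2 cmul (c w) (c' w));
  bsecJ : forall c, bsec c -> bsec (fun w => omap cstar (c w));
  bsec_norm : forall c, bsec c -> mcfun mu (fun w => omap Num.norm (c w));
  bsec_dense : forall w, dense [set x | exists2 c, bsec c & c w = Some x]
}.

Import HBSimple.

Section sections.
Context d (T : measurableType d) (R : realType).
Variables (mu : completeFiniteMeasure T R) (X : cstarBundle mu).
Local Notation C := R[i].
Local Notation Re := complex.Re.
Local Notation Im := complex.Im.
Implicit Types (f : psection (fun _ : T => C)) (u v : psection (fiber X)).

Definition simple_section (s : psection (fiber X)) :=
  exists n (A : 'I_n -> set T) (c : 'I_n -> psection (fiber X)),
    [/\ forall i, measurable (A i), forall i, bsec (c i) &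
      {ae mu, forall w,
        s w = Some (\sum_(i < n) (\1_(A i) w : C) *: odflt 0 (c i w))}].

(* M(Omega, X): u and the s n may be partial, but their domains are conull, so
   the default value 0 is irrelevant to the almost-everywhere limit. *)
Definition measurable_section (u : psection (fiber X)) :=
  {ae mu, forall w, u w} /\
  exists2 s : nat -> psection (fiber X), forall n, simple_section (s n) &
    {ae mu, forall w, odflt 0 (s n w) @[n --> \oo] --> odflt 0 (u w)}.

Let tot (g : forall w, X w) : psection (fiber X) := fun w => Some (g w).
Let tsimple g := simple_section (tot g).

Let simple_tot s : simple_section s -> tsimple (fun w => odflt 0 (s w)).
Proof.
move=> [n [A [c [mA Lc sE]]]]; exists n, A, c; split=> //.
by apply: filterS sE => w sw; rewrite /tot sw.
Qed.

Let tsimple_ae g h : {ae mu, forall w, g w = h w} -> tsimple g -> tsimple h.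
Proof.
move=> gh [n [A [c [mA Lc sE]]]]; exists n, A, c; split=> //.
by apply: filterS2 gh sE => w; rewrite /tot => <-.
Qed.

Let ae_ord n (Q : 'I_n -> T -> Prop) : (forall i, {ae mu, forall w, Q i w}) ->
  {ae mu, forall w, forall i, Q i w}.
Proof. exact: filter_forall. Qed.

Let tsimple0 : tsimple (fun w => 0).
Proof.
exists 0%N, (fun=> set0), (fun=> fun=> None); split; try by case.
by apply: aeW => w; rewrite big_ord0.
Qed.

Let tsimpleD g h : tsimple g -> tsimple h -> tsimple (fun w => g w + h w).
Proof.
move=> [n [A [c [mA Lc gE]]]] [m [B [b [mB Lb hE]]]].
exists (n + m)%N,
  (fun i => match fintype.split i with inl j => A j | inr j => B j end),
  (fun i => match fintype.split i with inl j => c j | inr j => b j end); split.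
- by move=> i; case: (fintype.split i).
- by move=> i; case: (fintype.split i).
apply: filterS2 gE hE => w; rewrite /tot => -[->] [->]; congr Some; rewrite big_split_ord.
by congr (_ + _); apply: eq_bigr => i _;
  rewrite ?(unsplitK (inl _ i)) ?(unsplitK (inr _ i)).
Qed.

Let bsecZ (a : C) c : bsec c -> bsec (fun w => omap ( *:%R a) (c w) : option (X w)).
Proof.
move=> Lc; rewrite (_ : (fun w => _) = fun w =>
  omap2 +%R (omap ( *:%R a) (c w)) (omap ( *:%R 0) (c w))).
  exact: bsec_lin.
apply: functional_extensionality_dep => w; case: (c w) => //= x.
by rewrite scale0r addr0.
Qed.

Let tsimpleZ (a : C) (B : set T) g : measurable B ->
  tsimple g -> tsimple (fun w => (a * \1_B w) *: g w).
Proof.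
move=> mB [n [A [c [mA Lc gE]]]].
exists n, (fun i => A i `&` B), (fun i w => omap ( *:%R a) (c i w)); split.
- by move=> i; exact: measurableI.
- by move=> i; exact: bsecZ.
apply: filterS2 (ae_ord (fun i => bsec_ae (Lc i))) gE => w cw; rewrite /tot => -[->].
congr Some; rewrite scaler_sumr; apply: eq_bigr => i _.
move: (cw i); case: (c i w) => //= x _.
by rewrite indicI /= !scalerA mulrAC [in RHS]mulrC mulrA [a * _ * _]mulrAC.
Qed.

Let tsimple_term (A : set T) c : measurable A -> bsec c ->
  tsimple (fun w => (\1_A w : C) *: odflt 0 (c w)).
Proof.
move=> mA Lc; exists 1%N, (fun=> A), (fun=> c); split => //.
by apply: aeW => w; rewrite big_ord1.
Qed.

Let tsimple_sum n (g : 'I_n -> forall w, X w) : (forall i, tsimple (g i)) ->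
  tsimple (fun w => \sum_(i < n) g i w).
Proof.
elim: n g => [|n IHn] g sg.
  by apply: tsimple_ae tsimple0; apply: aeW => w; rewrite big_ord0.
apply: tsimple_ae (tsimpleD (IHn _ (fun i => sg (widen_ord (leqnSn n) i)))
  (sg ord_max)).
by apply: aeW => w; rewrite big_ord_recr.
Qed.

Let cmul_suml (A : cstarAlgType R) n (f : 'I_n -> A) y :
  cmul (\sum_i f i) y = \sum_i cmul (f i) y.
Proof.
apply: (big_morph (cmul^~ y)) => [u v|]; first exact: cmulDl.
by rewrite -(scale0r (0 : A)) cmulZl !scale0r.
Qed.

Let cmul_sumr (A : cstarAlgType R) n (f : 'I_n -> A) y :
  cmul y (\sum_i f i) = \sum_i cmul y (f i).
Proof.
apply: (big_morph (cmul y)) => [u v|]; first exact: cmulDr.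
by rewrite -(scale0r (0 : A)) cmulZr !scale0r.
Qed.

Let tsimpleM g h : tsimple g -> tsimple h ->
  tsimple (fun w => cmul (g w) (h w)).
Proof.
move=> [n [A [c [mA Lc gE]]]] [m [B [b [mB Lb hE]]]].
have S i j : tsimple (fun w => (\1_(A i `&` B j) w : C) *:
    odflt 0 (omap2 cmul (c i w) (b j w))).
  by apply: tsimple_term; [exact: measurableI|exact: bsecM].
apply: tsimple_ae (tsimple_sum (fun i => tsimple_sum (S i))).
have cb : {ae mu, forall w, (forall i, c i w) /\ (forall i, b i w)}.
  by apply: filterI; apply: ae_ord => i; exact: bsec_ae.
apply: filterS3 gE hE cb => w; rewrite /tot => -[->] [->] [cw bw].
rewrite cmul_suml; apply: eq_bigr => i _; rewrite cmul_sumr.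
apply: eq_bigr => j _; rewrite cmulZl cmulZr scalerA indicI /=.
by case: (c i w) (b j w) (cw i) (bw j) => // x [].
Qed.

Let tsimpleJ g : tsimple g -> tsimple (fun w => cstar (g w)).
Proof.
move=> [n [A [c [mA Lc gE]]]].
exists n, A, (fun i w => omap cstar (c i w)); split=> //.
  by move=> i; exact: bsecJ.
apply: filterS2 (ae_ord (fun i => bsec_ae (Lc i))) gE => w cw; rewrite /tot => -[->].
congr Some; rewrite (big_morph _ (@cstarD _ _) (_ : cstar 0 = 0)); last first.
  by rewrite -(scale0r (0 : X w)) cstarZ rmorph0 !scale0r.
apply: eq_bigr => i _; rewrite cstarZ /indic rmorph_nat.
by case: (c i w) (cw i).
Qed.

Let tsimple_norm g : tsimple g -> measurable_fun setT (fun w => rnorm (g w)).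
Proof.
move=> [n [A [c [mA Lc gE]]]].
suff H c0 : bsec c0 -> measurable_fun setT (fun w =>
    rnorm (odflt 0 (c0 w) + \sum_(i < n) (\1_(A i) w : C) *: odflt 0 (c i w))).
  case: n A c mA Lc gE H => [|n] A c mA Lc gE H.
    apply: (ae_measurable_real (mu := mu) _ (measurable_cst (0 : R))).
    apply: filterS gE => w [->]; rewrite big_ord0.
    by rewrite /rnorm normr0.
  apply: (ae_measurable_real (mu := mu) _ (H _ (bsecZ 0 (Lc ord0)))).
  apply: filterS gE => w [->]; congr rnorm.
  by case: (c ord0 w) => [x|]; rewrite /= ?scale0r add0r.
elim: n A c mA Lc {gE} c0 => [|n IHn] A c mA Lc c0 Lc0.
  have [+ _] := total_mcfun (bsec_norm Lc0).
  apply: eq_measurable_fun => w _; rewrite big_ord0 addr0 /rnorm.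
  by case: (c0 w) => [x|] /=; rewrite ?normr0.
pose g0 (b : psection (fiber X)) w := rnorm (odflt 0 (b w) + \sum_(i < n)
  (\1_(A (widen_ord (leqnSn n) i)) w : C) *: odflt 0 (c (widen_ord (leqnSn n) i) w)).
have m0 b : bsec b -> measurable_fun setT (g0 b) by move=> Lb; exact: IHn.
pose c1 : psection (fiber X) := fun w => omap2 +%R (omap ( *:%R 1) (c0 w))
  (omap ( *:%R 1) (c ord_max w)).
have Lc1 : bsec c1 by exact: bsec_lin.
pose B := A ord_max.
have mB : measurable_fun setT (\1_B : T -> R) by apply: measurable_indic; exact: mA.
have mC : measurable_fun setT (\1_(~` B) : T -> R).
  by apply: measurable_indic; apply: measurableC; exact: mA.
apply: (ae_measurable_real (mu := mu) _ (measurable_funD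
  (measurable_funM mB (m0 _ Lc1)) (measurable_funM mC (m0 _ Lc0)))).
apply: filterS2 (bsec_ae Lc0) (bsec_ae (Lc ord_max)) => w.
rewrite /= big_ord_recr /= -/B /g0 /c1 !indicE in_setC.
case: (c0 w) (c ord_max w) => // x [] // y _ _ /=.
case: (w \in B); rewrite /= ?mul1r ?mul0r ?addr0 ?add0r ?scale0r ?addr0 //.
by rewrite !scale1r addrAC addrA.
Qed.

Let msec_tot u : {ae mu, forall w, u w} ->
  (exists2 s : nat -> forall w, X w, forall n, tsimple (s n) &
    {ae mu, forall w, s n w @[n --> \oo] --> odflt 0 (u w)}) ->
  measurable_section u.
Proof. by move=> u_ae [s ss su]; split=> //; exists (fun n => tot (s n)). Qed.

Let tot_msec u : measurable_section u ->
  exists2 s : nat -> forall w, X w, forall n, tsimple (s n) &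
    {ae mu, forall w, s n w @[n --> \oo] --> odflt 0 (u w)}.
Proof.
move=> [_ [s ss su]]; exists (fun n w => odflt 0 (s n w)) => // n.
exact: simple_tot.
Qed.

Lemma measurable_sectionD u v : measurable_section u -> measurable_section v ->
  measurable_section (fun w => omap2 +%R (u w) (v w)).
Proof.
move=> mu_ mv; have [[u_ae _] [v_ae _]] := (mu_, mv).
have [[s ss su] [t tt tv]] := (tot_msec mu_, tot_msec mv).
apply: msec_tot.
  by apply: filterS2 u_ae v_ae => w; case: (u w) (v w) => // x [].
exists (fun n w => s n w + t n w) => [n|]; first exact: tsimpleD.
near=> w.
have uw : u w by near: w.
have vw : v w by near: w.
have -> : odflt 0 (omap2 +%R (u w) (v w)) = odflt 0 (u w) + odflt 0 (v w).
  by case: (u w) (v w) uw vw => // x [].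
by apply: cvgD; near: w.
Unshelve. all: by end_near. Qed.

Lemma measurable_sectionM u v : measurable_section u -> measurable_section v ->
  measurable_section (fun w => omap2 cmul (u w) (v w)).
Proof.
move=> mu_ mv; have [[u_ae _] [v_ae _]] := (mu_, mv).
have [[s ss su] [t tt tv]] := (tot_msec mu_, tot_msec mv).
apply: msec_tot.
  by apply: filterS2 u_ae v_ae => w; case: (u w) (v w) => // x [].
exists (fun n w => cmul (s n w) (t n w)) => [n|]; first exact: tsimpleM.
near=> w.
have uw : u w by near: w.
have vw : v w by near: w.
have -> : odflt 0 (omap2 cmul (u w) (v w)) = cmul (odflt 0 (u w)) (odflt 0 (v w)).
  by case: (u w) (v w) uw vw => // x [].
by apply: cvg_cmul; near: w.
Unshelve. all: by end_near. Qed.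

Lemma measurable_sectionJ u : measurable_section u ->
  measurable_section (fun w => omap cstar (u w)).
Proof.
move=> mu_; have [u_ae _] := mu_; have [s ss su] := tot_msec mu_.
apply: msec_tot; first by apply: filterS u_ae => w; case: (u w).
exists (fun n w => cstar (s n w)) => [n|]; first exact: tsimpleJ.
near=> w.
have uw : u w by near: w.
have -> : odflt 0 (omap cstar (u w)) = cstar (odflt 0 (u w)).
  by case: (u w) uw.
by apply: cvg_cstar; near: w.
Unshelve. all: by end_near. Qed.

Let tsimpleZ_sfun (a : C) (f : {sfun T >-> R}) g : tsimple g ->
  tsimple (fun w => (a * (f w)%:C) *: g w).
Proof.
move=> sg.
have H (r : seq R) : tsimple (fun w =>
    (a * (\sum_(y <- r) y * \1_(f @^-1` [set y]) w)%:C) *: g w).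
  elim: r => [|y r IHr].
    apply: tsimple_ae tsimple0; apply: aeW => w.
    by rewrite big_nil mulr0 scale0r.
  have mf : measurable (f @^-1` [set y]) by exact: measurable_funPTI.
  apply: tsimple_ae (tsimpleD (tsimpleZ (a * y%:C) mf sg) IHr).
  apply: aeW => w; rewrite big_cons -scalerDl; congr (_ *: _).
  by rewrite rmorphD mulrDr rmorphM mulrA /indic rmorph_nat.
apply: (tsimple_ae _ (H (finmap.enum_fset (fset_set (range f))))); apply: aeW => w.
by rewrite -fsbig_finite// -fimfunE.
Qed.

Let sfun_approx (f : T -> R) : measurable_fun setT f ->
  exists f_ : {sfun T >-> R}^nat, forall w, f_ n w @[n --> \oo] --> f w.
Proof.
move=> /measurable_EFinP mf.
have [f_ f_f] := approximation_sfun measurableT mf.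
by exists f_ => w; exact: fine_cvg (f_f w I).
Qed.

Lemma measurable_sectionZ f u : mcfun mu f -> measurable_section u ->
  measurable_section (fun w => omap2 *:%R (f w) (u w)).
Proof.
move=> mf mu_; have [[f_ae _ _] [u_ae _]] := (mf, mu_).
have [mRe mIm] := total_mcfun mf.
have [[a aRe] [b bIm]] := (sfun_approx mRe, sfun_approx mIm).
have [s ss su] := tot_msec mu_.
apply: msec_tot.
  by apply: filterS2 f_ae u_ae => w; case: (f w) (u w) => // x [].
exists (fun n w => (1 * (a n w)%:C) *: s n w + ('i * (b n w)%:C) *: s n w).
  by move=> n; apply: tsimpleD; exact: tsimpleZ_sfun.
near=> w.
have fw : f w by near: w.
have uw : u w by near: w.
have sw : s n w @[n --> \oo] --> odflt 0 (u w) by near: w.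
have -> : odflt 0 (omap2 *:%R (f w) (u w)) =
    (1 * (Re (odflt 0 (f w)))%:C) *: odflt 0 (u w) +
    ('i * (Im (odflt 0 (f w)))%:C) *: odflt 0 (u w).
  rewrite -scalerDl mul1r.
  by case: (f w) (u w) fw uw => // x [] // y _ _ /=; rewrite -complexE.
rewrite -!scalerA; under eq_fun do rewrite -!scalerA.
apply: cvgD; apply: cvgZl_tmp; apply: cvg_scale_real => //; exact: aRe.
Unshelve. all: by end_near. Qed.

Lemma mcfun_section_norm u : measurable_section u ->
  mcfun mu (fun w => omap Num.norm (u w)).
Proof.
move=> mu_; have [u_ae _] := mu_; have [s ss su] := tot_msec mu_.
pose g w := rnorm (odflt 0 (u w)).
apply: (@mcfun_total _ _ _ _ _ (fun w => `|odflt 0 (u w)|)).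
- have [N [mN N0 subN]] := su.
  pose h n w := \1_(~` N) w * rnorm (s n w).
  apply: (@ae_measurable_real _ _ _ mu (fun w => \1_(~` N) w * g w)).
    exists N; split=> // w /= Pw; apply/not_notP => Nw; apply: Pw.
    by rewrite indicE mem_set // mul1r.
  apply: (@measurable_fun_cvg _ _ _ _ h) => [n|w _].
    apply: measurable_funM; last exact: tsimple_norm.
    by apply: measurable_indic; exact: measurableC.
  rewrite /h indicE; have [|wN] := boolP (w \in ~` N).
    rewrite inE => Nw; apply: cvgM; first exact: cvg_cst.
    by apply: rnorm_cvg; apply/not_notP => ?; exact/Nw/subN.
  by rewrite mul0r; under eq_fun do rewrite mul0r; exact: cvg_cst.
- apply: (@eq_measurable_fun _ _ _ _ _ (cst (0 : R))).
    by move=> w _; rewrite /= rnormE.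
  exact: measurable_cst.
- by apply: filterS u_ae => w; case: (u w).
Qed.

End sections.

Section L0_algebra.
Context d (T : measurableType d) (R : realType).
Variable mu : completeFiniteMeasure T R.
Local Notation C := R[i].
Local Notation Re := complex.Re.
Local Notation Im := complex.Im.

Definition L0 := aequot mu (@mcfun _ T R mu).

Definition L0cst (a : C) : L0 := aeclass mu (mcfun_cst mu a).

Definition L0add (f g : L0) : L0 :=
  aeclass mu (mcfunD (aereprP f) (aereprP g)).

Definition L0mul (f g : L0) : L0 :=
  aeclass mu (mcfunM (aereprP f) (aereprP g)).

Definition L0abs (f : L0) : L0 := aeclass mu (mcfun_norm (aereprP f)).

(* a <= b in R[i] means that b - a is a nonnegative real. *)
Definition L0le (f g : L0) :=
  {ae mu, forall w, odflt 0 (aerepr f w) <= odflt 0 (aerepr g w)}.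

Definition is_L0sup (S : set L0) (m : L0) :=
  (forall f, S f -> L0le f m) /\
  (forall g, (forall f, S f -> L0le f g) -> L0le m g).

Definition Linf (f : L0) :=
  exists2 a : R, 0 < a & L0le (L0abs f) (L0cst a%:C).

Definition Linf_norm (f : L0) : \bar R :=
  Lnorm mu +oo%E (fun w => (Re `|odflt 0 (aerepr f w)|)%:E).

Definition bounded_mfun (g : T -> C) :=
  mcfun mu (fun w => Some (g w)) /\ exists a : R, forall w, `|g w| <= a%:C.

Definition sup_norm (g : T -> C) : R := sup (range (fun w => Re `|g w|)).

(* Conditions on p matter only on L^oo(Omega); p takes everywhere-defined
   values. *)
Record is_lifting (p : L0 -> T -> C) : Prop := {
  lifting_bounded : forall f, Linf f -> bounded_mfun (p f);
  lifting_mem : forall f, Linf f ->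
    {ae mu, forall w, aerepr f w = Some (p f w)};
  lifting_norm : forall f, Linf f -> (sup_norm (p f))%:E = Linf_norm f;
  lifting1 : forall w, p (L0cst 1) w = 1;
  liftingD : forall f g, Linf f -> Linf g ->
    forall w, p (L0add f g) w = p f w + p g w;
  liftingZ : forall a f, Linf f ->
    forall w, p (L0mul (L0cst a) f) w = a * p f w;
  liftingM : forall f g, Linf f -> Linf g ->
    forall w, p (L0mul f g) w = p f w * p g w
}.

End L0_algebra.

Section L0X.
Context d (T : measurableType d) (R : realType).
Variables (mu : completeFiniteMeasure T R) (X : cstarBundle mu).
Local Notation C := R[i].

Definition L0X := aequot mu (@measurable_section _ T R mu X).

Definition L0Xadd (x y : L0X) : L0X :=
  aeclass mu (measurable_sectionD (aereprP x) (aereprP y)).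

Definition L0Xscale (f : L0 mu) (x : L0X) : L0X :=
  aeclass mu (measurable_sectionZ (aereprP f) (aereprP x)).

Definition L0Xmul (x y : L0X) : L0X :=
  aeclass mu (measurable_sectionM (aereprP x) (aereprP y)).

Definition L0Xstar (x : L0X) : L0X :=
  aeclass mu (measurable_sectionJ (aereprP x)).

Definition L0Xnorm (x : L0X) : L0 mu :=
  aeclass mu (mcfun_section_norm (aereprP x)).

Definition is_L0Xunit (e : L0X) :=
  forall x, L0Xmul e x = x /\ L0Xmul x e = x.

Definition LinfX (x : L0X) := Linf (L0Xnorm x).

Record is_vlifting (p : L0 mu -> T -> C) (l : L0X -> forall w, X w) : Prop := {
  vlifting_measurable : forall x, LinfX x ->
    measurable_section (fun w => Some (l x w));
  vlifting_bounded : forall x, LinfX x -> bounded_mfun mu (fun w => `|l x w|);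
  vlifting_mem : forall x, LinfX x ->
    {ae mu, forall w, aerepr x w = Some (l x w)};
  vlifting_norm : forall x, LinfX x -> forall w, `|l x w| = p (L0Xnorm x) w;
  vliftingD : forall x y, LinfX x -> LinfX y ->
    forall w, l (L0Xadd x y) w = l x w + l y w;
  vliftingZ : forall f x, Linf f -> LinfX x ->
    forall w, l (L0Xscale f x) w = p f w *: l x w;
  vliftingJ : forall x, LinfX x -> forall w, l (L0Xstar x) w = cstar (l x w);
  vliftingM : forall x y, LinfX x -> LinfX y ->
    forall w, l (L0Xmul x y) w = cmul (l x w) (l y w);
  vlifting_dense : forall w, dense [set l x w | x in LinfX]
}.

Definition L0linear (f : L0X -> L0 mu) :=
  forall a b x y, f (L0Xadd (L0Xscale a x) (L0Xscale b y)) =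
    L0add (L0mul a (f x)) (L0mul b (f y)).

Definition L0bounded (f : L0X -> L0 mu) :=
  exists c, forall x, L0le (L0abs (f x)) (L0mul c (L0Xnorm x)).

Definition L0positive (f : L0X -> L0 mu) :=
  forall x, L0le (L0cst mu 0) (f (L0Xmul x (L0Xstar x))).

Definition is_L0norm (f : L0X -> L0 mu) (n : L0 mu) :=
  is_L0sup [set L0abs (f x) | x in [set x | L0le (L0Xnorm x) (L0cst mu 1)]] n.

Definition is_L0state (f : L0X -> L0 mu) :=
  [/\ L0linear f, L0bounded f, L0positive f & is_L0norm f (L0cst mu 1)].

Definition is_measurable_bundle_of_states (f : forall w, {scalar (X w)}) :=
  (forall w, is_state (f w)) /\
  (forall u, measurable_section u -> mcfun mu (fun w => omap (f w) (u w))).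

End L0X.

(* Main.v *)
(* For x in L^oo(Omega, X) one has |phi x| <= |x| a.e., hence, p being monotone,
   |p (phi x) w| <= p |x| w = |l x w| at every w.  So l x w |-> p (phi x) w is a
   well defined contractive linear functional on a dense subspace of X w; let
   phi_ w be its continuous extension, which is positive.  A positive
   contraction f on a unital C*-algebra satisfies |f x| <= (1 + f e) / 2 on the
   unit ball; applied fibrewise this gives |phi x| <= (1 + phi e) / 2 a.e.
   whenever |x| <= 1, so that |phi| = 1 forces phi e = 1 and phi_ w (l e w) = 1
   everywhere.  A general x is reduced to the bounded section x / (1 + |x|). *)
Require Import Defs.
From HB Require Import structures.
From mathcomp Require Import all_boot all_order all_algebra.
From mathcomp Require Import all_classical all_reals all_analysis.
From mathcomp.real_closed Require Import complex.
From mathcomp Require Import measurable_realfun ring lra.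
Set Implicit Arguments.
Unset Strict Implicit.
Unset Printing Implicit Defensive.
Import Order.TTheory GRing.Theory Num.Theory numFieldNormedType.Exports.
Local Open Scope classical_set_scope.
Local Open Scope ring_scope.
Local Open Scope complex_scope.

(** * Complex numbers and the real-valued norm [rnorm] *)

Section complex_numbers.
Context {R : realType}.
Local Notation C := R[i].
Local Notation Re := complex.Re.
Local Notation Im := complex.Im.
Implicit Types x y z : C.

Lemma ReD x y : Re (x + y) = Re x + Re y. Proof. by case: x; case: y. Qed.
Lemma ImD x y : Im (x + y) = Im x + Im y. Proof. by case: x; case: y. Qed.
Lemma ReN x : Re (- x) = - Re x. Proof. by case: x. Qed.
Lemma ImN x : Im (- x) = - Im x. Proof. by case: x. Qed.

Lemma lecR1 (a : R) : (a%:C <= 1 :> C) = (a <= 1).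
Proof. by rewrite -lecR rmorph1. Qed.

Lemma abs_Re_le z : `|Re z| <= rnorm z.
Proof.
case: z => a b; rewrite /rnorm /= -sqrtr_sqr ler_wsqrtr// lerDl; exact: sqr_ge0.
Qed.

Lemma abs_Im_le z : `|Im z| <= rnorm z.
Proof.
case: z => a b; rewrite /rnorm /= -sqrtr_sqr ler_wsqrtr// lerDr; exact: sqr_ge0.
Qed.

Lemma rnorm_le_ReIm z : rnorm z <= `|Re z| + `|Im z|.
Proof.
case: z => a b; rewrite /rnorm /= -[leRHS]ger0_norm ?addr_ge0// -[leRHS]sqrtr_sqr.
rewrite ler_wsqrtr// sqrrD !real_normK ?num_real// -!addrA lerD2l.
by rewrite addrA lerDr -mulr2n mulrn_wge0// mulr_ge0.
Qed.

Lemma rnorm_eq0 (V : normedZmodType C) (v : V) : rnorm v = 0 -> v = 0.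
Proof. by move=> v0; apply/eqP; rewrite -normr_eq0 rnormE v0. Qed.

Lemma rnorm_mul x y : rnorm (x * y) = rnorm x * rnorm y.
Proof.
by apply: (fmorph_inj (real_complex R)); rewrite rmorphM /= -!rnormE normrM.
Qed.

Lemma rnormV x : rnorm x^-1 = (rnorm x)^-1.
Proof.
by apply: (fmorph_inj (real_complex R)); rewrite fmorphV /= -!rnormE normfV.
Qed.

Lemma rnorm_distC (V : normedZmodType C) (u v : V) : rnorm (u - v) = rnorm (v - u).
Proof. by rewrite /rnorm distrC. Qed.

Lemma rnorm_conj x : rnorm x^* = rnorm x.
Proof. by case: x => a b; rewrite /rnorm /= sqrrN. Qed.

Lemma mul_conj x : x * x^* = (rnorm x ^+ 2)%:C.
Proof.
case: x => a b; rewrite /rnorm /= sqr_sqrtr ?addr_ge0 ?sqr_ge0//.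
by apply/eqP; rewrite eq_complex /=; apply/andP; split; apply/eqP; ring.
Qed.

(** The half-line [0, +oo) is closed in the complex plane: a nonreal [z] stays at distance at least
    [|Im z|] from it, and a [z] with negative real part at distance at least [- Re z]. Positivity
    thus survives approximation. *)
Lemma ge0_complex_approx z :
  (forall eps : R, 0 < eps -> exists2 w, 0 <= w & rnorm (z - w) < eps) -> 0 <= z.
Proof.
move=> H; rewrite lecE /=; apply/andP; split.
  apply/negPn/negP => /eqP/eqP Imz.
  have [|w] := H `|Im z|; first by rewrite normr_gt0.
  rewrite lecE /= => /andP[/eqP Iw _]; rewrite ltNge => /negP; apply.
  by apply: le_trans (abs_Im_le _); rewrite ImD ImN Iw subr0.
rewrite leNgt; apply/negP => Rez.
have [|w] := H (- Re z); first by rewrite oppr_gt0.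
rewrite lecE /= => /andP[_ Rw]; rewrite ltNge => /negP; apply.
apply: le_trans (abs_Re_le _); rewrite ReD ReN -normrN ler_normr.
by apply/orP; left; lra.
Qed.

(** The half-plane Re >= 1 touches the closed unit disc only at 1. This turns a lower bound on the
    real part of phi e into an equality. *)
Lemma complex_eq1 z : rnorm z <= 1 -> 1 <= Re z -> z = 1.
Proof.
case: z => a b /= h a1; move: h; rewrite /rnorm /= -sqrtr1 ler_sqrt// => h.
apply/eqP; rewrite eq_complex /=.
have b0 : b ^+ 2 <= 0 by nra.
have : b ^+ 2 == 0 by rewrite eq_le b0 sqr_ge0.
rewrite sqrf_eq0 => -> /=; rewrite andbT eq_le a1 andbT; nra.
Qed.

End complex_numbers.

(** * Extending a linear contraction from a dense subspace *)

Section dense_extension.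
Context {R : realType} (V : normedModType R[i]) (D : set V) (F : V -> R[i]).
Local Notation C := R[i].
Local Notation Re := complex.Re.
Local Notation Im := complex.Im.

Lemma dense_rnorm (A : set V) : dense A ->
  forall x (eps : R), 0 < eps -> exists2 y, A y & rnorm (x - y) < eps.
Proof.
move=> dA x eps eps0.
have e0 : 0 < eps%:C by rewrite ltcR.
have [||y [xy Ay]] := dA (ball x eps%:C)^°.
- by exists x; exact: nbhsx_ballx.
- exact: open_interior.
exists y => //; have := interior_subset xy.
by rewrite -ball_normE /ball_ /= rnormE ltcR.
Qed.

(* McShane's formula *)
Lemma lipschitz_point_extension (G : V -> R) : D !=set0 ->
  (forall y y', D y -> D y' -> `|G y - G y'| <= rnorm (y - y')) ->
  forall x, exists z, forall y, D y -> `|G y - z| <= rnorm (x - y).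
Proof.
move=> [y0 Dy0] GL x; pose S := [set G y - rnorm (x - y) | y in D].
have ubS y : D y -> ubound S (G y + rnorm (x - y)).
  move=> Dy _ [y' Dy' <-]; have := GL _ _ Dy Dy'.
  rewrite distrC => /(le_trans (ler_norm _)) h.
  have := rnorm_triangle (y - x) (x - y'); rewrite addrA subrK.
  rewrite (rnorm_distC y x); lra.
have hS : has_sup S.
  split; [by exists (G y0 - rnorm (x - y0)); exists y0|].
  by exists (G y0 + rnorm (x - y0)); exact: ubS.
exists (sup S) => y Dy; rewrite ler_distlC.
apply/andP; split.
  by have := sup_upper_bound hS; apply; exists y.
by apply: ge_sup; [case: hS|exact: ubS].
Qed.

Hypothesis D_dense : dense D.
Hypothesis D_lin : forall (a : C) x y, D x -> D y -> D (a *: x + y).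
Hypothesis F_lin : forall (a : C) x y, D x -> D y ->
  F (a *: x + y) = a * F x + F y.
Hypothesis F_norm : forall x, D x -> rnorm (F x) <= rnorm x.

Let FB x y : D x -> D y -> D (x - y) /\ F (x - y) = F x - F y.
Proof.
move=> Dx Dy; have E : x - y = -1 *: y + x by rewrite scaleN1r addrC.
by rewrite E; split; [exact: D_lin|rewrite F_lin// mulN1r addrC].
Qed.

Let D_neq0 : D !=set0.
Proof. by have [y Dy _] := dense_rnorm D_dense 0 ltr01; exists y. Qed.

(** [Re \o F] and [Im \o F] are both 1-Lipschitz on [D], so each gets a candidate value at [x];
    adding the two errors gives the factor 2. The crude factor is harmless: since [D] is dense, the
    estimate still determines [z]. *)
Let point_extension x : exists z : C,
  forall y, D y -> rnorm (F y - z) <= 2 * rnorm (x - y).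
Proof.
have [y y' Dy Dy'|a Ha] := @lipschitz_point_extension (fun y => Re (F y)) D_neq0 _ x.
  have [Dyy' FE] := FB Dy Dy'.
  rewrite /= -ReN -ReD; apply: le_trans (abs_Re_le _) _.
  by rewrite -FE F_norm.
have [y y' Dy Dy'|b Hb] := @lipschitz_point_extension (fun y => Im (F y)) D_neq0 _ x.
  have [Dyy' FE] := FB Dy Dy'.
  rewrite /= -ImN -ImD; apply: le_trans (abs_Im_le _) _.
  by rewrite -FE F_norm.
exists (a +i* b) => y Dy; apply: le_trans (rnorm_le_ReIm _) _.
by rewrite ReD ImD ReN ImN /= mulr2n mulrDl mul1r lerD ?Ha ?Hb.
Qed.

(** A value chosen at each point by [point_extension] already gives the extension. Linearity and the
    sharp bound with constant 1 are recovered by approximating from [D], where both hold exactly. *)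
Lemma dense_extension : exists f : {scalar V},
  (forall x, D x -> f x = F x) /\ (forall x, rnorm (f x) <= rnorm x).
Proof.
have [f0 Hf0] := choice point_extension.
have f0D x : D x -> f0 x = F x.
  move=> Dx; apply/eqP; rewrite eq_sym -subr_eq0; apply/eqP/rnorm_eq0/eqP.
  rewrite eq_le rnorm_ge0 andbT (le_trans (Hf0 x x Dx))//.
  by rewrite subrr /rnorm normr0 /= mulr0.
have f0lin : scalar f0.
  move=> a x y; apply/eqP; rewrite -subr_eq0; apply/eqP/rnorm_eq0/eqP.
  rewrite eq_le rnorm_ge0 andbT; apply/ler_addgt0Pr => eps eps0; rewrite add0r.
  (* Approximating [x] and [y] within [d] costs at most 2(|a|d + d) for the values at [x] and [y],
     and as much again for the value at [a *: x + y]. This [d] makes the total equal to [eps]. *)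
  set d := eps / (4 * (rnorm a + 1)).
  have a0 := rnorm_ge0 a.
  have d0 : 0 < d by rewrite divr_gt0// mulr_gt0// ltr_wpDl.
  have dE : 4 * (rnorm a * d + d) = eps.
    rewrite /d; field; apply: lt0r_neq0; lra.
  have [x' Dx' xx'] := dense_rnorm D_dense x d0.
  have [y' Dy' yy'] := dense_rnorm D_dense y d0.
  have Dz := D_lin a Dx' Dy'.
  have e1 := Hf0 (a *: x + y) _ Dz; rewrite F_lin// in e1.
  have e2 := Hf0 x _ Dx'; have e3 := Hf0 y _ Dy'.
  have e4 : rnorm (a *: x + y - (a *: x' + y')) <= rnorm a * d + d.
    rewrite opprD addrACA -scalerBr (le_trans (rnorm_triangle _ _))//.
    by rewrite rnormZ lerD ?ler_wpM2l// ltW.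
  have -> : f0 (a *: x + y) - (a * f0 x + f0 y) =
     (a * (F x' - f0 x) + (F y' - f0 y)) - (a * F x' + F y' - f0 (a *: x + y)).
    by ring.
  rewrite (le_trans (rnorm_triangle _ _))// rnormN.
  have := rnorm_triangle (a * (F x' - f0 x)) (F y' - f0 y).
  rewrite rnorm_mul => e5.
  have e6 : rnorm a * rnorm (F x' - f0 x) <= rnorm a * (2 * d).
    by rewrite ler_wpM2l//; lra.
  lra.
pose fL := GRing.isLinear.Build C V C _ f0 f0lin.
pose f : {scalar V} := HB.pack f0 fL.
exists f; split => // x; apply/ler_addgt0Pr => eps eps0.
(* One third is lost in comparing |y| with |x|, two thirds in comparing [F y] with [f0 x]. *)
have e3 : 0 < eps / 3 by lra.
have [y Dy xy] := dense_rnorm D_dense x e3.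
have e1 := Hf0 x y Dy; have e2 := F_norm Dy.
rewrite /f /=.
have -> : f0 x = F y - (F y - f0 x) by rewrite opprB addrC subrK.
rewrite (le_trans (rnorm_triangle _ _))// rnormN.
have := rnorm_triangle x (y - x); rewrite addrC subrK (rnorm_distC y x); lra.
Qed.

End dense_extension.

(** * Positive contractive functionals on a unital C*-algebra *)

Section positive_functional.
Context {R : realType} (A : cstarAlgType R) (f : {scalar A}) (e : A).
Local Notation Re := complex.Re.
Hypothesis f_pos : forall x, 0 <= f (cmul x (cstar x)).
Hypothesis f_norm : forall x, rnorm (f x) <= rnorm x.
Hypothesis e_unit : forall x, cmul e x = x /\ cmul x e = x.

Lemma cstar_unit : cstar e = e.
Proof.
have := cstarM e (cstar e); rewrite cstarK (e_unit _).1 cstarK.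
by move=> <-.
Qed.

Let f_expand (a : R[i]) x : f (cmul (e + a *: x) (cstar (e + a *: x))) =
  f e + a^* * f (cstar x) + a * f x + (a * a^*) * f (cmul x (cstar x)).
Proof.
rewrite cstarD cstarZ cstar_unit cmulDl !cmulDr !cmulZl !cmulZr.
rewrite !(e_unit _).1 !(e_unit _).2 scalerA !linearD !linearZ /=.
by rewrite !addrA.
Qed.

Lemma positive_Re_cstar x : Re (f (cstar x)) = Re (f x).
Proof.
have fe := f_pos e; rewrite cstar_unit (e_unit _).1 in fe.
have fx := f_pos x; have fy := f_pos (e + 'i *: x).
move: fx fy fe; rewrite f_expand !lecE /=.
case: (f e) (f x) (f (cstar x)) (f (cmul x _)) => a b [c d] [g h] [j k] /=.
do 3 move=> /andP[/eqP ? _]; lra.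
Qed.

Lemma positive_contraction_le x : rnorm x <= 1 ->
  rnorm (f x) <= (1 + Re (f e)) / 2.
Proof.
move=> x1; have fe := f_pos e; rewrite cstar_unit (e_unit _).1 in fe.
have Rfe : 0 <= Re (f e) by move: fe; rewrite lecE /= => /andP[].
have [->|fx0] := eqVneq (rnorm (f x)) 0; first lra.
(* The conjugate phase of [f x], unimodular because [f x] is nonzero here. *)
pose a : R[i] := (f x)^* * ((rnorm (f x))^-1)%:C.
have a1 : a * a^* = 1.
  rewrite mul_conj /a rnorm_mul rnorm_conj rnormR ger0_norm ?invr_ge0 ?rnorm_ge0//.
  by rewrite mulfV// expr1n.
have afx : a * f x = (rnorm (f x))%:C.
  rewrite /a mulrAC [_^* * _]mulrC mul_conj -rmorphM /= expr2 -mulrA.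
  by rewrite mulfV// mulr1.
have := positive_Re_cstar (a *: x); rewrite cstarZ !linearZ /= afx => Rax.
have := f_pos (e + (- a) *: x); rewrite f_expand rmorphN.
rewrite !mulNr mulrN mulNr opprK a1 mul1r.
rewrite lecE /= => /andP[_]; rewrite !ReD !ReN Rax afx /=.
have : Re (f (cmul x (cstar x))) <= 1.
  apply: le_trans (ler_norm _) _; apply: le_trans (abs_Re_le _) _.
  apply: le_trans (f_norm _) _; apply: le_trans (rnormM _ _) _.
  by rewrite rnorm_star mulr_ile1// rnorm_ge0.
lra.
Qed.

End positive_functional.

(** * Measurability of conjugates and inverses *)

Section complex_measurable.
Context d (T : measurableType d) (R : realType).
Local Notation C := R[i].
Local Notation Re := complex.Re.
Local Notation Im := complex.Im.

Definition cmeasurable (g : T -> C) :=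
  measurable_fun setT (fun w => Re (g w)) /\
  measurable_fun setT (fun w => Im (g w)).

Lemma cmeasurable_conj g : cmeasurable g -> cmeasurable (fun w => (g w)^*).
Proof.
move=> [mR mI]; split.
  by apply: eq_measurable_fun mR => w _; case: (g w).
by apply: eq_measurable_fun (measurable_funN mI) => w _ /=; case: (g w).
Qed.

Lemma cmeasurable_inv g : cmeasurable g -> cmeasurable (fun w => (g w)^-1).
Proof.
move=> [mR mI].
pose n w := Re (g w) ^+ 2 + Im (g w) ^+ 2.
have mn : measurable_fun setT (fun w => (n w)^-1).
  have mn : measurable_fun setT n.
    by apply: measurable_funD; exact: measurable_funX.
  (* The power -1 agrees with the inverse on all of [0, +oo), including at 0, where both are 0. *)
  have := measurableT_comp (@measurable_powR R (-1)) mn.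
  apply: eq_measurable_fun => w _ /=.
  by rewrite powR_inv1// /n addr_ge0// sqr_ge0.
split.
  have := measurable_funM mR mn.
  by apply: eq_measurable_fun => w _; rewrite /n /=; case: (g w).
have := measurable_funN (measurable_funM mI mn).
apply: eq_measurable_fun => w _.
by rewrite /n /=; case: (g w).
Qed.

End complex_measurable.

(** * Classes in L0 read as total functions *)

Section L0_values.
Context d (T : measurableType d) (R : realType).
Variable mu : completeFiniteMeasure T R.
Local Notation C := R[i].
Implicit Types f g : L0 mu.

(** The default 0 occurs only off the domain of the representative, which is a null set, so
    identities between classes become a.e. identities between total functions. *)
Definition L0val f (w : T) : C := odflt 0 (aerepr f w).

Lemma L0val_ae f : {ae mu, forall w, aerepr f w = Some (L0val f w)}.
Proof.
have [f_ae _ _] := aereprP f.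
by apply: filterS f_ae => w; rewrite /L0val; case: (aerepr f w).
Qed.

Lemma cmeasurable_L0val f : cmeasurable (L0val f).
Proof. exact: total_mcfun (aereprP f). Qed.

Lemma L0P f g : {ae mu, forall w, L0val f w = L0val g w} -> f = g.
Proof.
move=> fg; apply/aequotP; apply: filterS3 fg (L0val_ae f) (L0val_ae g) => w.
by move=> fg -> ->; rewrite fg.
Qed.

Lemma L0_exists (h : T -> C) : cmeasurable h ->
  exists f, {ae mu, forall w, L0val f w = h w}.
Proof.
move=> [mR mI].
have mh : mcfun mu (fun w => Some (h w)).
  by apply: (mcfun_total mR mI); exact: aeW.
exists (aeclass mu mh); have := aeclassK mu mh.
by apply: filterS => w; rewrite /L0val => ->.
Qed.

Lemma L0valD f g : {ae mu, forall w, L0val (L0add f g) w = L0val f w + L0val g w}.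
Proof.
have := aeclassK mu (mcfunD (aereprP f) (aereprP g)).
by apply: filterS3 (L0val_ae f) (L0val_ae g) => w; rewrite /L0val => fw gw -> /=;
  rewrite fw gw.
Qed.

Lemma L0valM f g : {ae mu, forall w, L0val (L0mul f g) w = L0val f w * L0val g w}.
Proof.
have := aeclassK mu (mcfunM (aereprP f) (aereprP g)).
by apply: filterS3 (L0val_ae f) (L0val_ae g) => w; rewrite /L0val => fw gw -> /=;
  rewrite fw gw.
Qed.

Lemma L0val_abs f : {ae mu, forall w, L0val (L0abs f) w = `|L0val f w|}.
Proof.
have := aeclassK mu (mcfun_norm (aereprP f)).
by apply: filterS2 (L0val_ae f) => w; rewrite /L0val => fw -> /=; rewrite fw.
Qed.

Lemma L0val_cst (a : C) : {ae mu, forall w, L0val (L0cst mu a) w = a}.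
Proof.
have := aeclassK mu (mcfun_cst mu a).
by apply: filterS => w; rewrite /L0val => ->.
Qed.

Lemma L0leE f g : L0le f g = {ae mu, forall w, L0val f w <= L0val g w}.
Proof. by []. Qed.

Lemma LinfP f : Linf f <->
  exists a : R, {ae mu, forall w, rnorm (L0val f w) <= a}.
Proof.
split=> [[a a0]|[a fa]].
  rewrite L0leE => fa.
  exists a; apply: filterS3 fa (L0val_abs f) (L0val_cst a%:C) => w.
  by move=> + E E'; rewrite E E' rnormE lecR.
exists (`|a| + 1); first by rewrite ltr_wpDl.
rewrite L0leE.
apply: filterS3 fa (L0val_abs f) (L0val_cst (`|a| + 1)%:C) => w fa E E'.
rewrite E E' rnormE lecR (le_trans fa)//.
by rewrite (le_trans (ler_norm _))// lerDl.
Qed.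

Lemma LinfD f g : Linf f -> Linf g -> Linf (L0add f g).
Proof.
move=> /LinfP[a fa] /LinfP[b gb]; apply/LinfP; exists (a + b).
apply: filterS3 fa gb (L0valD f g) => w fa gb ->.
by rewrite (le_trans (rnorm_triangle _ _))// lerD.
Qed.

Lemma LinfM f g : Linf f -> Linf g -> Linf (L0mul f g).
Proof.
move=> /LinfP[a fa] /LinfP[b gb]; apply/LinfP; exists (a * b).
apply: filterS3 fa gb (L0valM f g) => w fa gb ->.
by rewrite rnorm_mul ler_pM ?rnorm_ge0.
Qed.

Lemma Linf_cst (a : C) : Linf (L0cst mu a).
Proof. by apply/LinfP; exists (rnorm a); apply: filterS (L0val_cst a) => w ->. Qed.

Lemma L0conj_exists f : exists g, {ae mu, forall w, L0val g w = (L0val f w)^*}.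
Proof. exact/L0_exists/cmeasurable_conj/cmeasurable_L0val. Qed.

(** With the convention 0^-1 = 0 the inverse exists in L0 even when [f] vanishes on a set of
    positive measure; [L0state_norm] divides by a norm in this sense. *)
Lemma L0inv_exists f : exists g, {ae mu, forall w, L0val g w = (L0val f w)^-1}.
Proof. exact/L0_exists/cmeasurable_inv/cmeasurable_L0val. Qed.

End L0_values.

(** * Passing from almost everywhere to everywhere through the lifting *)

Section lifting.
Context d (T : measurableType d) (R : realType).
Variables (mu : completeFiniteMeasure T R) (p : L0 mu -> T -> R[i]).
Local Notation C := R[i].
Hypothesis p_lifting : is_lifting p.
Implicit Types f g : L0 mu.

Lemma lifting_cst a w : p (L0cst mu a) w = a.
Proof.
have <- : L0mul (L0cst mu a) (L0cst mu 1) = L0cst mu a.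
  apply: L0P; have H := L0valM (L0cst mu a) (L0cst mu 1).
  apply: filterS3 (L0val_cst mu a) (L0val_cst mu 1) H => w' E1 E2 ->.
  by rewrite E1 E2 mulr1.
by rewrite (liftingZ p_lifting) ?(lifting1 p_lifting) ?mulr1//; exact: Linf_cst.
Qed.

(* The pair [(p f w0, p g w0)] lies in the joint essential range of [(f, g)]:
   otherwise [1] would lie in the ideal generated by [f - p f w0] and
   [g - p g w0] in L^oo, which the character [p _ w0] annihilates. *)
Lemma lifting_approx f g w0 (eps : R) (Q : T -> Prop) : Linf f -> Linf g ->
  0 < eps -> {ae mu, forall w, Q w} ->
  exists w, [/\ Q w, rnorm (p f w0 - L0val f w) < eps &
                     rnorm (p g w0 - L0val g w) < eps].
Proof.
move=> bf bg eps0 aeQ; apply/not_existsP => noW.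
pose f1 := L0add f (L0cst mu (- p f w0)).
pose g1 := L0add g (L0cst mu (- p g w0)).
have f1E : {ae mu, forall w, L0val f1 w = L0val f w - p f w0}.
  have := L0valD f (L0cst mu (- p f w0)).
  by apply: filterS2 (L0val_cst mu (- p f w0)) => w + -> => ->.
have g1E : {ae mu, forall w, L0val g1 w = L0val g w - p g w0}.
  have := L0valD g (L0cst mu (- p g w0)).
  by apply: filterS2 (L0val_cst mu (- p g w0)) => w + -> => ->.
have bf1 : Linf f1 by apply: LinfD => //; exact: Linf_cst.
have bg1 : Linf g1 by apply: LinfD => //; exact: Linf_cst.
have pf1 : p f1 w0 = 0.
  by rewrite (liftingD p_lifting)// ?lifting_cst ?subrr//; exact: Linf_cst.
have pg1 : p g1 w0 = 0.
  by rewrite (liftingD p_lifting)// ?lifting_cst ?subrr//; exact: Linf_cst.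
have [f2 f2E] := L0conj_exists f1.
have [g2 g2E] := L0conj_exists g1.
(* This element of the ideal is |f1|^2 + |g1|^2. By [noW], at almost every point one of the two
   terms is at least [eps ^+ 2], so [n] has a bounded inverse. *)
pose n := L0add (L0mul f1 f2) (L0mul g1 g2).
have nE : {ae mu, forall w,
    L0val n w = (rnorm (L0val f1 w) ^+ 2 + rnorm (L0val g1 w) ^+ 2)%:C}.
  have H := L0valD (L0mul f1 f2) (L0mul g1 g2).
  apply: filterS3 H (filterI (L0valM f1 f2) f2E) (filterI (L0valM g1 g2) g2E) => w.
  by move=> -> [-> ->] [-> ->]; rewrite !mul_conj -rmorphD.
have n_lb : {ae mu, forall w, eps ^+ 2 <= rnorm (L0val n w)}.
  apply: filterS3 (filterI f1E g1E) nE aeQ => w [f1w g1w] -> Qw.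
  rewrite f1w g1w rnormR ger0_norm ?addr_ge0 ?sqr_ge0//.
  have [h|h] := ltP (rnorm (p f w0 - L0val f w)) eps.
    have [h'|h'] := ltP (rnorm (p g w0 - L0val g w)) eps; first by case: (noW w).
    apply: ler_wpDl; first exact: sqr_ge0.
    by rewrite ler_sqr ?nnegrE ?rnorm_ge0 ?(ltW eps0)// rnorm_distC.
  apply: ler_wpDr; first exact: sqr_ge0.
  by rewrite ler_sqr ?nnegrE ?rnorm_ge0 ?(ltW eps0)// rnorm_distC.
have [v vE] := L0inv_exists n.
have bv : Linf v.
  apply/LinfP; exists (eps ^+ 2)^-1; apply: filterS2 vE n_lb => w -> h.
  by rewrite rnormV lef_pV2// posrE ?exprn_gt0// (lt_le_trans _ h)// exprn_gt0.
have Linf_conj (h k : L0 mu) : Linf h ->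
    {ae mu, forall w, L0val k w = (L0val h w)^*} -> Linf k.
  move=> /LinfP[m hm] kE; apply/LinfP; exists m.
  by apply: filterS2 kE hm => w ->; rewrite rnorm_conj.
have bf2 := Linf_conj _ _ bf1 f2E; have bg2 := Linf_conj _ _ bg1 g2E.
have E1 : L0mul n v = L0cst mu 1.
  apply: L0P; apply: filterS3 (filterI (L0valM n v) vE) n_lb (L0val_cst mu 1).
  move=> w [-> ->] h ->; rewrite mulfV//; apply/eqP => n0; move: h.
  by rewrite n0 rnormR normr0 leNgt exprn_gt0.
have := lifting1 p_lifting w0.
have b1 := LinfM bf1 bf2; have b2 := LinfM bg1 bg2.
rewrite -E1 (liftingM p_lifting)//; last exact: LinfD.
rewrite (liftingD p_lifting)// !(liftingM p_lifting)// pf1 pg1.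
by rewrite !mul0r addr0 mul0r => /eqP; rewrite eq_sym oner_eq0.
Qed.

(** [lifting_approx] yields a point where the a.e. inequality holds and where both functions are
    within eps / 2 of their lifted values at [w]. *)
Lemma lifting_rnorm_le f g : Linf f -> Linf g ->
  {ae mu, forall w, rnorm (L0val g w) <= rnorm (L0val f w)} ->
  forall w, rnorm (p g w) <= rnorm (p f w).
Proof.
move=> bf bg gf w; apply/ler_addgt0Pr => eps eps0.
have e2 : 0 < eps / 2 by lra.
have [w' [gfw fw gw]] := lifting_approx w bf bg e2 gf.
have := rnorm_dist (p g w) (L0val g w'); rewrite ler_norml => /andP[_].
have := rnorm_dist (p f w) (L0val f w'); rewrite ler_norml => /andP[+ _].
lra.
Qed.

Lemma lifting_ge0 f : Linf f -> {ae mu, forall w, 0 <= L0val f w} ->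
  forall w, 0 <= p f w.
Proof.
move=> bf f0 w; apply: ge0_complex_approx => eps eps0.
by have [w' [? ? _]] := lifting_approx w bf bf eps0 f0; exists (L0val f w').
Qed.

End lifting.

(** * Classes of measurable sections read as total sections *)

Section L0X_values.
Context d (T : measurableType d) (R : realType).
Variables (mu : completeFiniteMeasure T R) (X : cstarBundle mu).
Local Notation C := R[i].
Implicit Types (x y : L0X X) (f : L0 mu).

Definition Xval x (w : T) : X w := odflt 0 (aerepr x w).

Lemma Xval_ae x : {ae mu, forall w, aerepr x w = Some (Xval x w)}.
Proof.
have [x_ae _] := aereprP x.
by apply: filterS x_ae => w; rewrite /Xval; case: (aerepr x w).
Qed.

Lemma XP x y : {ae mu, forall w, Xval x w = Xval y w} -> x = y.
Proof.
move=> xy; apply/aequotP; apply: filterS3 xy (Xval_ae x) (Xval_ae y) => w.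
by move=> xy -> ->; rewrite xy.
Qed.

Lemma XvalD x y : {ae mu, forall w, Xval (L0Xadd x y) w = Xval x w + Xval y w}.
Proof.
have := aeclassK mu (measurable_sectionD (aereprP x) (aereprP y)).
by apply: filterS3 (Xval_ae x) (Xval_ae y) => w; rewrite /Xval => xw yw -> /=;
  rewrite xw yw.
Qed.

Lemma XvalZ f x : {ae mu, forall w, Xval (L0Xscale f x) w = L0val f w *: Xval x w}.
Proof.
have := aeclassK mu (measurable_sectionZ (aereprP f) (aereprP x)).
apply: filterS3 (L0val_ae f) (Xval_ae x) => w; rewrite /Xval /L0val.
by move=> fw xw -> /=; rewrite fw xw.
Qed.

Lemma XvalM x y : {ae mu, forall w, Xval (L0Xmul x y) w = cmul (Xval x w) (Xval y w)}.
Proof.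
have := aeclassK mu (measurable_sectionM (aereprP x) (aereprP y)).
by apply: filterS3 (Xval_ae x) (Xval_ae y) => w; rewrite /Xval => xw yw -> /=;
  rewrite xw yw.
Qed.

Lemma XvalJ x : {ae mu, forall w, Xval (L0Xstar x) w = cstar (Xval x w)}.
Proof.
have := aeclassK mu (measurable_sectionJ (aereprP x)).
by apply: filterS2 (Xval_ae x) => w; rewrite /Xval => xw -> /=; rewrite xw.
Qed.

Lemma L0val_norm x : {ae mu, forall w, L0val (L0Xnorm x) w = (rnorm (Xval x w))%:C}.
Proof.
have := aeclassK mu (mcfun_section_norm (aereprP x)).
by apply: filterS2 (Xval_ae x) => w; rewrite /Xval /L0val => xw -> /=;
  rewrite xw /= rnormE.
Qed.

Lemma LinfXP x : LinfX x <->
  exists a : R, {ae mu, forall w, rnorm (Xval x w) <= a}.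
Proof.
rewrite /LinfX; split=> [/LinfP[a ha]|[a ha]]; [exists a|apply/LinfP; exists a];
  by apply: filterS2 ha (L0val_norm x) => w + E;
    rewrite E rnormR ger0_norm ?rnorm_ge0.
Qed.

Lemma L0Xnorm_le1 x : {ae mu, forall w, rnorm (Xval x w) <= 1} <->
  L0le (L0Xnorm x) (L0cst mu 1).
Proof.
rewrite L0leE; split; apply: filterS3 (L0val_norm x) (L0val_cst mu 1) => w -> ->;
  by rewrite lecR1.
Qed.

Lemma LinfXD x y : LinfX x -> LinfX y -> LinfX (L0Xadd x y).
Proof.
move=> /LinfXP[a xa] /LinfXP[b yb]; apply/LinfXP; exists (a + b).
apply: filterS3 xa yb (XvalD x y) => w xa yb ->.
by rewrite (le_trans (rnorm_triangle _ _))// lerD.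
Qed.

Lemma LinfXZ f x : Linf f -> LinfX x -> LinfX (L0Xscale f x).
Proof.
move=> /LinfP[a fa] /LinfXP[b xb]; apply/LinfXP; exists (a * b).
apply: filterS3 fa xb (XvalZ f x) => w fa xb ->.
by rewrite rnormZ ler_pM ?rnorm_ge0.
Qed.

Lemma LinfXM x y : LinfX x -> LinfX y -> LinfX (L0Xmul x y).
Proof.
move=> /LinfXP[a xa] /LinfXP[b yb]; apply/LinfXP; exists (a * b).
apply: filterS3 xa yb (XvalM x y) => w xa yb ->.
by rewrite (le_trans (rnormM _ _))// ler_pM ?rnorm_ge0.
Qed.

Lemma LinfXJ x : LinfX x -> LinfX (L0Xstar x).
Proof.
move=> /LinfXP[a xa]; apply/LinfXP; exists a.
by apply: filterS2 xa (XvalJ x) => w + ->; rewrite rnorm_star.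
Qed.

End L0X_values.

(** * Consequences of L0-linearity and of the L0-norm being 1 *)

Section L0_states.
Context d (T : measurableType d) (R : realType).
Variables (mu : completeFiniteMeasure T R) (X : cstarBundle mu).
Local Notation C := R[i].
Variable phi : L0X X -> L0 mu.
Hypothesis phi_lin : L0linear phi.
Implicit Types (x y : L0X X) (f : L0 mu).

(** [L0linear] speaks of two-term combinations, so f x is written as f x + 0 x. *)
Lemma L0linearZ f x :
  {ae mu, forall w, L0val (phi (L0Xscale f x)) w = L0val f w * L0val (phi x) w}.
Proof.
have -> : L0Xscale f x = L0Xadd (L0Xscale f x) (L0Xscale (L0cst mu 0) x).
  apply: XP; apply: filterS3 (XvalD (L0Xscale f x) (L0Xscale (L0cst mu 0) x))
    (XvalZ (L0cst mu 0) x) (L0val_cst mu 0) => w -> -> ->.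
  by rewrite scale0r addr0.
rewrite phi_lin.
apply: filterS3 (L0valD (L0mul f (phi x)) (L0mul (L0cst mu 0) (phi x)))
  (filterI (L0valM f (phi x)) (L0valM (L0cst mu 0) (phi x)))
  (L0val_cst mu 0) => w -> [-> ->] ->.
by rewrite mul0r addr0.
Qed.

(** The shape in which linearity over [R[i]] is checked for a [scalar] map on a fibre. *)
Definition L0Xaxpy (a : C) x y := L0Xadd (L0Xscale (L0cst mu a) x) y.

Lemma L0linear_axpy (a : C) x y :
  phi (L0Xaxpy a x y) = L0add (L0mul (L0cst mu a) (phi x)) (phi y).
Proof.
have -> : L0Xaxpy a x y = L0Xadd (L0Xscale (L0cst mu a) x) (L0Xscale (L0cst mu 1) y).
  congr L0Xadd; apply: XP.
  by apply: filterS2 (XvalZ (L0cst mu 1) y) (L0val_cst mu 1) => w -> ->; rewrite scale1r.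
rewrite phi_lin; congr L0add; apply: L0P.
by apply: filterS2 (L0valM (L0cst mu 1) (phi y)) (L0val_cst mu 1) => w -> ->; rewrite mul1r.
Qed.

Hypothesis phi_norm : is_L0norm phi (L0cst mu 1).

Lemma L0state_le1 x : {ae mu, forall w, rnorm (Xval x w) <= 1} ->
  {ae mu, forall w, rnorm (L0val (phi x) w) <= 1}.
Proof.
move=> /L0Xnorm_le1 x1; have [ub _] := phi_norm.
have : L0le (L0abs (phi x)) (L0cst mu 1) by apply: ub; exists x.
rewrite L0leE; apply: filterS3 (L0val_abs (phi x)) (L0val_cst mu 1) => w -> ->.
by rewrite rnormE lecR1.
Qed.

(** Write x = |x| y with y = |x|^-1 x, which vanishes where x does. Then y lies in the unit ball,
    and L0-linearity pulls |x| out of phi. *)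
Lemma L0state_norm x :
  {ae mu, forall w, rnorm (L0val (phi x) w) <= rnorm (Xval x w)}.
Proof.
have [v vE] := L0inv_exists (L0Xnorm x); pose y := L0Xscale v x.
have vE' : {ae mu, forall w, L0val v w = ((rnorm (Xval x w))^-1)%:C}.
  by apply: filterS2 vE (L0val_norm x) => w -> ->; rewrite fmorphV.
have y1 : {ae mu, forall w, rnorm (Xval y w) <= 1}.
  apply: filterS2 (XvalZ v x) vE' => w -> ->.
  rewrite rnormZ rnormR ger0_norm ?invr_ge0 ?rnorm_ge0//.
  by have [->|n0] := eqVneq (rnorm (Xval x w)) 0; rewrite ?mulr0// mulVf.
have xE : phi x = phi (L0Xscale (L0Xnorm x) y).
  congr phi.
  apply: XP.
  apply: filterS3 (XvalZ (L0Xnorm x) y) (filterI (XvalZ v x) vE') (L0val_norm x).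
  move=> w -> [-> ->] ->; rewrite scalerA -rmorphM /=.
  have [n0|n0] := eqVneq (rnorm (Xval x w)) 0; last by rewrite mulfV// scale1r.
  by rewrite (rnorm_eq0 n0) scaler0.
apply: filterS3 (L0linearZ (L0Xnorm x) y) (L0state_le1 y1) (L0val_norm x) => w.
rewrite xE => -> h ->; rewrite rnorm_mul rnormR ger0_norm ?rnorm_ge0//.
by rewrite ler_piMr ?rnorm_ge0.
Qed.

Lemma L0state_Linf x : LinfX x -> Linf (phi x).
Proof.
move=> /LinfXP[a xa]; apply/LinfP; exists a.
by apply: filterS2 (L0state_norm x) xa => w; exact: le_trans.
Qed.

End L0_states.

(** * The functionals on the fibres and their properties *)

Section fiber_states.
Context d (T : measurableType d) (R : realType).
Variables (mu : completeFiniteMeasure T R) (X : cstarBundle mu).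
Variables (p : L0 mu -> T -> R[i]) (l : L0X X -> forall w, X w).
Variables (e : L0X X) (phi : L0X X -> L0 mu).
Local Notation C := R[i].
Local Notation Re := complex.Re.
Hypothesis p_lifting : is_lifting p.
Hypothesis l_lifting : is_vlifting p l.
Hypothesis phi_lin : L0linear phi.
Hypothesis phi_norm : is_L0norm phi (L0cst mu 1).
Implicit Types x y : L0X X.

Let phi_Linf := L0state_Linf phi_lin phi_norm.

Lemma LinfX_axpy (a : C) x y : LinfX x -> LinfX y -> LinfX (L0Xaxpy a x y).
Proof. by move=> bx b_y; apply: LinfXD => //; apply: LinfXZ => //; exact: Linf_cst. Qed.

Lemma vlifting_axpy (a : C) x y w : LinfX x -> LinfX y ->
  l (L0Xaxpy a x y) w = a *: l x w + l y w.
Proof.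
move=> bx b_y; have ba := Linf_cst mu a.
rewrite (vliftingD l_lifting)//; last exact: LinfXZ.
by rewrite (vliftingZ l_lifting)// (lifting_cst p_lifting).
Qed.

Lemma lifting_phi_axpy (a : C) x y w : LinfX x -> LinfX y ->
  p (phi (L0Xaxpy a x y)) w = a * p (phi x) w + p (phi y) w.
Proof.
move=> bx b_y; have ba := Linf_cst mu a; rewrite (L0linear_axpy phi_lin).
rewrite (liftingD p_lifting) ?(liftingZ p_lifting)//; try exact: phi_Linf.
by apply: LinfM => //; exact: phi_Linf.
Qed.

Lemma vlifting_rnorm x w : LinfX x -> rnorm (l x w) = rnorm (p (L0Xnorm x) w).
Proof.
by move=> bx; rewrite -(vlifting_norm l_lifting)// rnormE rnormR ger0_norm ?rnorm_ge0.
Qed.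

Lemma lifting_phi_le x w : LinfX x -> rnorm (p (phi x) w) <= rnorm (l x w).
Proof.
move=> bx; rewrite vlifting_rnorm//.
apply: (lifting_rnorm_le p_lifting) => //; first exact: phi_Linf.
apply: filterS2 (L0state_norm phi_lin phi_norm x) (L0val_norm x) => w' + ->.
by rewrite rnormR ger0_norm ?rnorm_ge0.
Qed.

Lemma fiber_functional w : exists f : {scalar (X w)},
  (forall x, LinfX x -> f (l x w) = p (phi x) w) /\
  (forall z, rnorm (f z) <= rnorm z).
Proof.
(* Well-definedness: [lifting_phi_le] is applied to the difference of [y] and [x], whose lifting
   vanishes at [w]. *)
have eq_l x y : LinfX x -> LinfX y -> l x w = l y w -> p (phi x) w = p (phi y) w.
  move=> bx b_y lxy; apply/eqP; rewrite -subr_eq0; apply/eqP/rnorm_eq0/eqP.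
  rewrite eq_le rnorm_ge0 andbT addrC -mulN1r -lifting_phi_axpy//.
  rewrite (le_trans (lifting_phi_le _ _)) ?vlifting_axpy//; first exact: LinfX_axpy.
  by rewrite lxy scaleN1r addNr /rnorm normr0.
have [z|F FE] := @choice _ _
    (fun z (c : C) => forall x, LinfX x -> l x w = z -> c = p (phi x) w).
  have [[x bx <-]|noz] := pselect (exists2 x, LinfX x & l x w = z).
    by exists (p (phi x) w) => y b_y /esym; exact: eq_l.
  (* The value 0 off the image of [l] at [w] is arbitrary; [dense_extension] looks at [F] on the
     image only. *)
  by exists 0 => x bx xz; case: noz; exists x.
have [||||f [fE f_le]] := @dense_extension _ _ [set l x w | x in @LinfX _ _ _ _ X] F.
- exact: (vlifting_dense l_lifting).
- move=> a _ _ [x bx <-] [y b_y <-]; exists (L0Xaxpy a x y); first exact: LinfX_axpy.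
  exact: vlifting_axpy.
- move=> a _ _ [x bx <-] [y b_y <-].
  rewrite !(FE _ _ bx erefl) !(FE _ _ b_y erefl) -lifting_phi_axpy//.
  by apply: FE; [exact: LinfX_axpy|exact: vlifting_axpy].
- by move=> _ [x bx <-]; rewrite (FE _ _ bx erefl); exact: lifting_phi_le.
exists f; split=> // x bx; rewrite fE; last by exists x.
exact: FE.
Qed.

Hypothesis phi_pos : L0positive phi.

Section fiber.
Variables (w : T) (f : {scalar (X w)}).
Hypothesis fE : forall x, LinfX x -> f (l x w) = p (phi x) w.
Hypothesis f_le : forall z, rnorm (f z) <= rnorm z.

Lemma fiber_positive z : 0 <= f (cmul z (cstar z)).
Proof.
apply: ge0_complex_approx => eps eps0.
have z0 := rnorm_ge0 z.
(* The bound 1 keeps |y| <= |z| + 1 for the approximant y. Then z z^* - y y^* = (z - y) z^* + y (z -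
   y)^* has norm at most |z - y| times 2(|z| + 1), hence less than [eps]. *)
pose dl := Num.min 1 (eps / (2 * (rnorm z + 1))).
have q0 : 0 < 2 * (rnorm z + 1) by lra.
have dl0 : 0 < dl by rewrite lt_min ltr01 divr_gt0.
have [_ [x bx <-] zx] := dense_rnorm (vlifting_dense l_lifting (w := w)) z dl0.
have bs := LinfXJ bx.
exists (f (cmul (l x w) (cstar (l x w)))).
  rewrite -(vliftingJ l_lifting)// -(vliftingM l_lifting)// fE; last exact: LinfXM.
  apply: (lifting_ge0 p_lifting); first exact/phi_Linf/LinfXM.
  have := phi_pos x; rewrite L0leE.
  by apply: filterS2 (L0val_cst mu 0) => w' ->.
set y := l x w in zx *.
have -> : f (cmul z (cstar z)) - f (cmul y (cstar y)) =
    f (cmul (z - y) (cstar z) + cmul y (cstar (z - y))).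
  rewrite -linearB; congr (f _).
  rewrite -[- y]scaleN1r cmulDl cmulZl cstarD cstarZ cmulDr cmulZr.
  by rewrite rmorphN rmorph1 !scaleN1r addrA subrK.
apply: le_lt_trans (f_le _) _; apply: le_lt_trans (rnorm_triangle _ _) _.
have h1 := rnormM (z - y) (cstar z); have h2 := rnormM y (cstar (z - y)).
rewrite rnorm_star in h1; rewrite rnorm_star in h2.
have y1 : rnorm y <= rnorm z + 1.
  have := rnorm_dist z y; rewrite ler_norml => /andP[+ _].
  have : dl <= 1 by rewrite /dl ge_min lexx.
  lra.
have dle : dl * (2 * (rnorm z + 1)) <= eps.
  by rewrite -ler_pdivlMr// /dl ge_min lexx orbT.
have h3 : rnorm (z - y) * rnorm z <= rnorm (z - y) * (rnorm z + 1).
  by rewrite ler_wpM2l ?rnorm_ge0//; lra.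
have h4 : rnorm y * rnorm (z - y) <= (rnorm z + 1) * rnorm (z - y).
  by rewrite ler_wpM2r ?rnorm_ge0.
have h5 : rnorm (z - y) * (2 * (rnorm z + 1)) < dl * (2 * (rnorm z + 1)).
  by rewrite ltr_pM2r.
lra.
Qed.

End fiber.

Hypothesis e_unit : is_L0Xunit e.
Hypothesis e_norm : L0Xnorm e = L0cst mu 1.

Lemma LinfX_unit : LinfX e.
Proof. by rewrite /LinfX e_norm; exact: Linf_cst. Qed.

Lemma fiber_unit_norm w : rnorm (l e w) = 1.
Proof.
by rewrite (vlifting_rnorm _ LinfX_unit) e_norm (lifting_cst p_lifting) rnormR normr1.
Qed.

(** Multiplicativity of [l] gives the identities on the lifted elements. Replacing [z] by one of
    them within eps / 2 costs at most twice that distance, as [l e w] has norm 1. *)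
Lemma fiber_unit w z : cmul (l e w) z = z /\ cmul z (l e w) = z.
Proof.
have be := LinfX_unit.
have dn := vlifting_dense l_lifting (w := w).
have E x : LinfX x -> cmul (l e w) (l x w) = l x w /\ cmul (l x w) (l e w) = l x w.
  by move=> bx; rewrite -!(vliftingM l_lifting)// (e_unit x).1 (e_unit x).2.
have sub a b : a - b = a + (-1 : C) *: b :> X w by rewrite scaleN1r.
split; apply/eqP; rewrite -subr_eq0; apply/eqP/rnorm_eq0/eqP;
  rewrite eq_le rnorm_ge0 andbT; apply/ler_addgt0Pr => eps eps0; rewrite add0r;
  have e2 : 0 < eps / 2 by lra.
- have [_ [x bx <-] zx] := dense_rnorm dn z e2.
  have -> : cmul (l e w) z - z = cmul (l e w) (z - l x w) - (z - l x w).
    by rewrite sub [z - l x w]sub cmulDr cmulZr (E x bx).1 -!sub opprB addrA subrK.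
  rewrite (le_trans (rnorm_triangle _ _))// rnormN.
  by have := rnormM (l e w) (z - l x w); rewrite fiber_unit_norm; lra.
- have [_ [x bx <-] zx] := dense_rnorm dn z e2.
  have -> : cmul z (l e w) - z = cmul (z - l x w) (l e w) - (z - l x w).
    by rewrite sub [z - l x w]sub cmulDl cmulZl (E x bx).2 -!sub opprB addrA subrK.
  rewrite (le_trans (rnorm_triangle _ _))// rnormN.
  by have := rnormM (z - l x w) (l e w); rewrite fiber_unit_norm; lra.
Qed.

(** The class of (1 + Re (phi e)) / 2 bounds |phi x| on the unit ball, so it dominates the supremum
    1. Hence Re (phi e) >= 1 a.e., while |phi e| <= 1. *)
Lemma L0state_unit : phi e = L0cst mu 1.
Proof.
have be := LinfX_unit; have bpe := phi_Linf be.
have [mR mI] := cmeasurable_L0val (phi e).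
have [g gE] : exists g : L0 mu, {ae mu, forall w,
    L0val g w = ((1 + Re (L0val (phi e) w)) / 2)%:C}.
  apply: L0_exists; split; last exact: measurable_cst.
  by apply: measurable_funM; [exact: measurable_funD|exact: measurable_cst].
have leg : L0le (L0cst mu 1) g.
  have [_ lub] := phi_norm; apply: lub => _ [x /L0Xnorm_le1 x1 <-].
  rewrite L0leE; have bx : LinfX x by apply/LinfXP; exists 1.
  (* The inequality is proved at every [w] in the fibre, where |l x w| <= 1 by monotonicity of the
     lifting; [lifting_mem] then brings it back to the classes. *)
  have H w : rnorm (p (phi x) w) <= (1 + Re (p (phi e) w)) / 2.
    have [f [fE f_le]] := fiber_functional w.
    rewrite -fE// -fE//; apply: positive_contraction_le => //.
    - exact: fiber_positive.
    - exact: fiber_unit.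
    rewrite vlifting_rnorm//.
    have <- : rnorm (p (L0cst mu 1) w) = 1.
      by rewrite (lifting_cst p_lifting) rnormR normr1.
    apply: (lifting_rnorm_le p_lifting) => //; first exact: Linf_cst.
    apply: filterS3 (L0val_norm x) (L0val_cst mu 1) x1 => w' -> ->.
    by rewrite !rnormR normr1 ger0_norm ?rnorm_ge0.
  apply: filterS3 (lifting_mem p_lifting (phi_Linf bx)) (lifting_mem p_lifting bpe)
    (filterI gE (L0val_abs (phi x))) => w E1 E2 [E3 E4].
  rewrite E4 E3 /L0val E1 E2 /=.
  by rewrite rnormE lecR.
apply: L0P.
have e1 : {ae mu, forall w, rnorm (L0val (phi e) w) <= 1}.
  apply: (L0state_le1 phi_norm); apply/L0Xnorm_le1; rewrite e_norm.
  by apply: aeW.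
rewrite L0leE in leg; apply: filterS3 (filterI e1 leg) gE (L0val_cst mu 1) => w.
move=> [h1 +] E1 E2; rewrite E1 E2 -(rmorph1 (real_complex R)) lecR => h2.
by apply: complex_eq1 => //; lra.
Qed.

Lemma fiber_state w (f : {scalar (X w)}) :
  (forall x, LinfX x -> f (l x w) = p (phi x) w) ->
  (forall z, rnorm (f z) <= rnorm z) -> is_state f.
Proof.
move=> fE f_le; split=> [z|S]; first exact: fiber_positive.
have ubS : ubound S 1.
  by move=> _ [z /= z1 <-]; apply: le_trans (f_le z) _; rewrite -lecR1 -rnormE.
(* The supremum is attained at the unit of the fibre. *)
have S1 : S 1.
  exists (l e w); first by rewrite /= rnormE fiber_unit_norm.
  by rewrite fE ?L0state_unit ?(lifting_cst p_lifting) ?normr1//; exact: LinfX_unit.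
split; first by exists 1.
by apply/eqP; rewrite eq_le ge_sup//=; [apply: ub_le_sup => //; exists 1|exists 1].
Qed.

(** For the bounded section y = x / (1 + |x|), both liftings agree a.e. with the classes they lift,
    so phi y and the fibre values coincide a.e. Both sides are linear in the factor 1 / (1 + |x|),
    which never vanishes and cancels. *)
Lemma fiber_functional_ae (f : forall w, {scalar (X w)}) :
  (forall w x, LinfX x -> f w (l x w) = p (phi x) w) ->
  forall x, {ae mu, forall w, L0val (phi x) w = f w (Xval x w)}.
Proof.
move=> fE x; pose n := L0add (L0cst mu 1) (L0Xnorm x).
have [v vE] := L0inv_exists n.
have {}vE : {ae mu, forall w, L0val v w = ((1 + rnorm (Xval x w))^-1)%:C}.
  apply: filterS3 (filterI vE (L0valD (L0cst mu 1) (L0Xnorm x)))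
    (L0val_cst mu 1) (L0val_norm x) => w [-> ->] -> ->.
  by rewrite -(rmorph1 (real_complex R)) -rmorphD fmorphV.
pose y := L0Xscale v x.
have b_y : LinfX y.
  apply/LinfXP; exists 1; apply: filterS2 (XvalZ v x) vE => w -> ->.
  have n0 := rnorm_ge0 (Xval x w).
  rewrite rnormZ rnormR ger0_norm ?invr_ge0 ?addr_ge0//.
  by rewrite mulrC ler_pdivrMr ?mul1r; lra.
have e1 := lifting_mem p_lifting (phi_Linf b_y).
have e2 := vlifting_mem l_lifting b_y.
apply: filterS3 (filterI e1 e2) (filterI vE (XvalZ v x)) (L0linearZ phi_lin v x).
move=> w [E1 E2] [E3 E4] E5; move: E4 E5; rewrite /Xval {1}E2 /L0val {1}E1 /=.
rewrite -!/(L0val _ w) -/(Xval x w) => E4 E5.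
have v0 : L0val v w != 0.
  rewrite E3 -(rmorph0 (real_complex R)) (inj_eq (fmorph_inj _)) invr_eq0.
  by have := rnorm_ge0 (Xval x w); lra.
apply: (mulfI v0); rewrite -E5 -fE// E4.
by rewrite linearZ.
Qed.

End fiber_states.

(** * Assembling the fibre functionals into a measurable bundle of states *)

Theorem theorem3p3 (d : measure_display) (T : measurableType d) (R : realType)
    (mu : completeFiniteMeasure T R) (X : cstarBundle mu)
    (p : L0 mu -> T -> R[i]) (l : L0X X -> forall w, X w) (e : L0X X)
    (phi : L0X X -> L0 mu) :
  is_lifting p -> is_vlifting p l ->
  is_L0Xunit e -> L0Xnorm e = L0cst mu 1 ->
  is_L0state phi ->
  exists2 phi_ : forall w, {scalar (X w)},
    is_measurable_bundle_of_states phi_ &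
    forall x : L0X X,
      {ae mu, forall w, aerepr (phi x) w = omap (phi_ w) (aerepr x w)}.
Proof.
move=> lp ll eu en [phi_lin _ phi_pos phi_norm].
pose H := fiber_functional lp ll phi_lin phi_norm.
pose f w := sval (cid (H w)).
have fE w x : LinfX x -> f w (l x w) = p (phi x) w by exact: (svalP (cid (H w))).1.
have f_le w z : rnorm (f w z) <= rnorm z by exact: (svalP (cid (H w))).2.
have fae := fiber_functional_ae lp ll phi_lin phi_norm fE.
have faer x : {ae mu, forall w, aerepr (phi x) w = omap (f w) (aerepr x w)}.
  by apply: filterS3 (fae x) (L0val_ae (phi x)) (Xval_ae x) => w E -> ->; rewrite E.
exists f => //; split=> [w|u mu_].
  by apply: (fiber_state lp ll phi_lin phi_norm phi_pos eu en) => //; exact: fE.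
(* Measurability of the bundle comes from the representation itself: w |-> f w (u w) agrees a.e.
   with phi of the class of [u], which is measurable, and [mu] is complete. *)
have [mR mI] := cmeasurable_L0val (phi (aeclass mu mu_)).
apply: (mcfun_total mR mI).
apply: filterS3 (faer (aeclass mu mu_)) (aeclassK mu mu_)
  (L0val_ae (phi (aeclass mu mu_))) => w.
by move=> E1 <- <-; rewrite E1.
Qed.
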